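(* For all integers $n\geq 1$ and $d\geq 3$, let $f=\sum_{|\alpha|=d}\varepsilon_\alpha x^\alpha$ be the random sign form of degree $d$ in $x_0,\ldots,x_n$ and $X_f\subset\mathbb P^n_{\mathbb C}$ the hypersurface it defines. Then $$\mathbf P(\dim\operatorname{Sing}X_f\geq 1)\leq\frac{n(n+1)d^{n-1}}{2^{\lfloor (d-1)/3\rfloor+1}}.$$
   Context: For a tuple $\alpha=(\alpha_0,\ldots,\alpha_n)$ of nonnegative integers put $|\alpha|=\alpha_0+\cdots+\alpha_n$ and $x^\alpha=x_0^{\alpha_0}\cdots x_n^{\alpha_n}$. The coefficients $\varepsilon_\alpha$, one for each $\alpha$ with $|\alpha|=d$, are independent random variables, each equal to $1$ or $-1$ with probability $1/2$; $\mathbf P$ denotes the resulting probability. $X_f\subset\mathbb P^n_{\mathbb C}$ is the closed subscheme $f=0$ with its scheme structure, including any repeated factors. $\operatorname{Sing}X_f$ is the closed set of singular (non-smooth) points of $X_f$, with the convention $\dim\varnothing=-1$. *)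

(* Defs.v *)
From HB Require Import structures.
From mathcomp Require Import all_boot all_order all_algebra.
From mathcomp Require Import complex mpoly.
From mathcomp Require Import classical_sets reals constructive_ereal ereal.
From mathcomp Require Import measure lebesgue_measure probability.

Set Implicit Arguments.
Unset Strict Implicit.
Unset Printing Implicit Defensive.

Import Order.TTheory GRing.Theory Num.Theory.

Local Open Scope ring_scope.
Local Open Scope complex_scope.
Local Open Scope classical_set_scope.

Section ProjectiveSpace.
Variables (K : closedFieldType) (n : nat).

(* P^n(K) as the set of lines of K^(n+1).  Closed points suffice: the dimension
   of a closed subset of a scheme of finite type over K is that of its set of
   closed points. *)
Record proj := Proj {
  line :> {vspace 'rV[K]_n.+1};
  dim_line : \dim line == 1%N
}.

Definition vanishes (g : {mpoly K[n.+1]}) (p : proj) : Prop :=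
  forall v : 'rV[K]_n.+1, v \in line p -> g.@[v ord0] = 0.

Definition zariski_closed (Z : set proj) : Prop :=
  exists S : set {mpoly K[n.+1]},
    (forall g, S g -> exists e : nat, g \is e.-homog) /\
    Z = [set p | forall g, S g -> vanishes g p].

Definition irreducible (Z : set proj) : Prop :=
  Z !=set0 /\
  forall A B : set proj, zariski_closed A -> zariski_closed B ->
    Z `<=` A `|` B -> Z `<=` A \/ Z `<=` B.

Definition has_chain (Z : set proj) (k : nat) : Prop :=
  exists Y : nat -> set proj,
    (forall i, (i <= k)%N ->
       [/\ zariski_closed (Y i), irreducible (Y i) & Y i `<=` Z]) /\
    (forall i, (i < k)%N -> Y i `<` Y i.+1).

(* Krull dimension of a closed set [Z], with value -1 on the empty set. *)
Definition krull_dim (R : realType) (Z : set proj) : \bar R :=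
  ereal_sup ((-1)%:E |` [set (k%:R)%:E | k in has_chain Z]).

Definition hypersurface (f : {mpoly K[n.+1]}) : set proj :=
  [set p | vanishes f p].

(* Equation, in the coordinates x_j / x_i (j != i), of the trace of the
   hypersurface f = 0 on the chart x_i != 0. *)
Definition dehomogenize (i : 'I_n.+1) (f : {mpoly K[n.+1]}) : {mpoly K[n]} :=
  f \mPo [tuple oapp (fun k : 'I_n => 'X_k) 1 (unlift i j) | j < n.+1].

(* For f != 0 the scheme f = 0 has pure dimension n - 1, so it is smooth at one
   of its points p iff the Jacobian of its equation in an affine chart around p
   has rank 1 at p.  The equation itself is used, not a reduced one, so every
   point of a repeated factor is singular. *)
Definition smooth_at (f : {mpoly K[n.+1]}) (p : proj) : Prop :=
  exists (i : 'I_n.+1) (v : 'rV[K]_n.+1),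
    [/\ v \in line p, v ord0 i = 1 &
      exists k : 'I_n,
        (dehomogenize i f)^`M(k).@[fun j => v ord0 (lift i j)] != 0].

Definition Sing (f : {mpoly K[n.+1]}) : set proj :=
  [set p | hypersurface f p /\ ~ smooth_at f p].

End ProjectiveSpace.

Definition exponent (n d : nat) := {a : 'X_{1..n.+1 < d.+1} | mdeg a == d}.

Definition form_of (R : realType) (n d : nat) (c : exponent n d -> R) :
    {mpoly R[i][n.+1]} :=
  \sum_(a : exponent n d) (c a)%:C *: 'X_[val a].

Section RandomSigns.
Context {disp : measure_display} {Omega : measurableType disp} {R : realType}.
Variable P : probability Omega R.

Definition mutually_independent (I : finType) (X : I -> {RV P >-> R}) : Prop :=
  forall (J : {set I}) (A : I -> set R), (forall i, measurable (A i)) ->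
    P [set w | forall i, i \in J -> A i (X i w)] =
    (\prod_(i in J) P [set w | A i (X i w)])%E.

(* The values are +-1 everywhere, not just almost surely, so that every event
   defined through the signs is measurable. *)
Definition random_sign (X : {RV P >-> R}) : Prop :=
  [/\ forall w, X w = 1 \/ X w = -1,
      P [set w | X w = 1] = (2^-1)%:E
    & P [set w | X w = -1] = (2^-1)%:E].

End RandomSigns.

(* Main.v *)
Require Import Defs.
From HB Require Import structures.
From mathcomp Require Import all_boot all_order all_algebra.
From mathcomp Require Import perm mpoly ring zify.

(* Reduce the signs modulo 3 and put [m = (d - 1) / 3].  For a chart [x_i], a
   coordinate [x_j] and [b <= m], the coefficients of the special monomials
   [x_l x_j^(3b) x_i^(d-1-3b)], l != i, enter only one of the [n] partial
   derivatives along the [x_l], l != i: the one with respect to [x_l], to which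
   they contribute a form [u_l] in [x_i] and [x_j] that determines their signs.
   The remaining parts [h_l] of these partials are [n] polynomials of degree < d
   in the [n - 1] other variables over F_3[x_i, x_j]; by Perron's theorem they
   satisfy a nonzero relation [Q(h) = 0] of degree at most [d^(n-1)].  Modulo the
   partials [h_l = - u_l], so the ideal of the partials contains the binary form
   [Q(- u)], which by Schwartz-Zippel vanishes with probability at most
   [d^(n-1) / 2^(m+1)].  There are [n (n + 1)] pairs (i, j).

   If the ideal contains nonzero binary forms in all pairs of variables, its
   Hilbert function modulo 3 is bounded, hence also in characteristic 0 by
   semicontinuity of ranks, so over the complex numbers too there is in every
   pair of variables a nonzero binary form vanishing wherever all partials do.
   It is a product of linear forms, so an irreducible subset of the singular
   locus is a point. *)

Set Implicit Arguments.
Unset Strict Implicit.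
Unset Printing Implicit Defensive.

Import Order.TTheory GRing.Theory Num.Theory.

Local Open Scope ring_scope.

(** * Polynomials with restricted support *)

Section SupportedIn.
Variables (A : comNzRingType) (k : nat).
Implicit Types (p q : {mpoly A[k]}) (P Q : 'X_{1..k} -> Prop).

(** Degree bounds stated on the support hold for the zero polynomial without a case distinction. *)
Definition supported P p := forall mu, mu \in msupp p -> P mu.

Lemma supportedW P Q p :
  (forall mu, P mu -> Q mu) -> supported P p -> supported Q p.
Proof. by move=> PQ hp mu /hp /PQ. Qed.

Lemma supported0 P : supported P 0.
Proof. by move=> mu; rewrite msupp0. Qed.

Lemma supportedX (P : 'X_{1..k} -> Prop) mu : P mu -> supported P 'X_[mu].
Proof. by move=> Pmu nu; rewrite msuppX inE => /eqP->. Qed.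

Lemma supportedZ P a p : supported P p -> supported P (a *: p).
Proof. by move=> hp mu /msuppZ_le /hp. Qed.

Lemma supportedC (P : 'X_{1..k} -> Prop) a : P 0%MM -> supported P a%:MP.
Proof.
by move=> P0; rewrite -[a%:MP]mulr1 mul_mpolyC -mpolyX0; apply: supportedZ; exact: supportedX.
Qed.

Lemma supportedD P p q : supported P p -> supported P q -> supported P (p + q).
Proof.
by move=> hp hq mu /msuppD_le; rewrite mem_cat => /orP[/hp|/hq].
Qed.

Lemma supported_sum (I : Type) (r : seq I) (S : pred I) (F : I -> {mpoly A[k]}) P :
  (forall i, S i -> supported P (F i)) -> supported P (\sum_(i <- r | S i) F i).
Proof.
by move=> hF; elim/big_rec: _ => [|i p Si hp];
  [exact: supported0 | apply: supportedD => //; exact: hF].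
Qed.

Lemma supportedM P Q S p q :
  (forall mu nu, P mu -> Q nu -> S (mu + nu)%MM) ->
  supported P p -> supported Q q -> supported S (p * q).
Proof.
move=> PQS hp hq mu /msuppM_le /allpairsP[[m1 m2] /= [/hp h1 /hq h2 ->]].
exact: PQS.
Qed.

Definition coef_supported P (c : {poly {mpoly A[k]}}) :=
  forall j, supported P c`_j.

Lemma coef_supportedW P Q c :
  (forall mu, P mu -> Q mu) -> coef_supported P c -> coef_supported Q c.
Proof. by move=> PQ hc j; apply: supportedW PQ _. Qed.

Lemma coef_supported0 P : coef_supported P 0.
Proof. by move=> j; rewrite coef0; exact: supported0. Qed.

Lemma coef_supportedC P p : supported P p -> coef_supported P p%:P.
Proof. by move=> hp j; rewrite coefC; case: ifP => // _; exact: supported0. Qed.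

Lemma coef_supportedXn (P : 'X_{1..k} -> Prop) N : P 0%MM -> coef_supported P 'X^N.
Proof.
move=> P0 j; rewrite coefXn; case: eqP => _; last exact: supported0.
by rewrite -mpolyX0; exact: supportedX.
Qed.

Lemma coef_supportedD P c e :
  coef_supported P c -> coef_supported P e -> coef_supported P (c + e).
Proof. by move=> hc he j; rewrite coefD; exact: supportedD. Qed.

Lemma coef_supported_sum (I : Type) (r : seq I) (S : pred I)
    (F : I -> {poly {mpoly A[k]}}) P :
  (forall i, S i -> coef_supported P (F i)) ->
  coef_supported P (\sum_(i <- r | S i) F i).
Proof.
by move=> hF; elim/big_rec: _ => [|i p Si hp];
  [exact: coef_supported0 | apply: coef_supportedD => //; exact: hF].
Qed.

Lemma coef_supportedM P Q S c e :
  (forall mu nu, P mu -> Q nu -> S (mu + nu)%MM) ->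
  coef_supported P c -> coef_supported Q e -> coef_supported S (c * e).
Proof.
move=> PQS hc he j; rewrite coefM; apply: supported_sum => i _.
exact: supportedM PQS _ _.
Qed.

End SupportedIn.

(** * Perron's theorem *)

Lemma rmorph_mmap (k : nat) (R S T : comNzRingType) (g : {rmorphism S -> T})
    (f : {rmorphism R -> S}) (h : 'I_k -> S) (q : {mpoly R[k]}) :
  g (mmap f h q) = mmap (g \o f) (g \o h) q.
Proof.
rewrite /mmap rmorph_sum; apply: eq_bigr => m _; rewrite rmorphM rmorph_prod.
by congr (_ * _); apply: eq_bigr => i _; rewrite rmorphXn.
Qed.

(** * Rewriting in monomials with all exponents below d *)

Section Reduction.
Variables (A : idomainType) (k d : nat) (p : 'I_k.+1 -> {mpoly A[k]}).
Hypotheses (d_gt0 : (0 < d)%N) (p_size : forall l, (msize (p l) <= d)%N).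

Let Y := {mpoly A[k]}.
Let Z := {mpoly A[k.+1]}.
Let box := {ffun 'I_k -> 'I_d}.
Let mbox (b : box) : 'X_{1..k} := [multinom (b i : nat) | i < k].

(** Once [X] is inverted, the added terms [X * y_i^d] make every y_i integral over the perturbed
    polynomials, whatever [p] is; [X = 0] gives [p] back. The last polynomial is left alone:
    multiplication by it is the operator to be studied. *)
Definition perturbed (l : 'I_k.+1) : {poly Y} :=
  (p l)%:P + (if unlift ord_max l is Some i then 'X * ('X_i ^+ d)%:P else 0).

Variable ev : {rmorphism {poly Z} -> {poly Y}}.
Hypotheses (evC : forall q, ev q%:P = mmap (@polyC _ \o @mpolyC k A) perturbed q)
           (evX : ev 'X = 'X).

(** The last variable goes to the outer indeterminate, the other variables to 0 and the parameter to
    the inner indeterminate. This detects that the determinant in Perron's theorem is nonzero. *)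
Variable theta : {rmorphism {poly Z} -> {poly {poly A}}}.
Hypotheses (thetaC : forall q, theta q%:P =
              mmap (@polyC _ \o @polyC A)
                   (fun l : 'I_k.+1 => if l == ord_max then 'X else 0) q)
           (thetaX : theta 'X = 'X%:P).

(** Each variable of [Z] has weight [d], a bound for the degree in y of the polynomial that [ev]
    substitutes for it. Here [s] is the degree of the polynomial being expanded and [t] that of the
    monomial whose coefficient is bounded. *)
Definition weight_le (s t : nat) (mu : 'X_{1..k.+1}) := (d * mdeg mu + t <= s)%N.

Definition admissible (s t : nat) (c : {poly Z}) :=
  coef_supported (weight_le s t) c /\ exists e, theta c = e%:P.

Lemma weight_leD s t s' t' mu nu :
  weight_le s t mu -> weight_le s' t' nu -> weight_le (s + s') (t + t') (mu + nu).
Proof. rewrite /weight_le mdegD; lia. Qed.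

Lemma admissibleM s t s' t' c c' :
  admissible s t c -> admissible s' t' c' -> admissible (s + s') (t + t') (c * c').
Proof.
move=> [hc [e he]] [hc' [e' he']]; split.
  by apply: coef_supportedM hc hc' => mu nu; exact: weight_leD.
by exists (e * e'); rewrite rmorphM he he' polyCM.
Qed.

Lemma admissibleD s t c c' :
  admissible s t c -> admissible s t c' -> admissible s t (c + c').
Proof.
move=> [hc [e he]] [hc' [e' he']]; split; first exact: coef_supportedD.
by exists (e + e'); rewrite rmorphD he he' polyCD.
Qed.

Lemma admissible0 s t : admissible s t 0.
Proof. by split; [exact: coef_supported0 | exists 0; rewrite rmorph0]. Qed.

Lemma admissibleXn N : admissible 0 0 'X^N.
Proof.
split; last by exists 'X^N; rewrite rmorphXn thetaX polyC_exp.
by apply: coef_supportedXn; rewrite /weight_le mdeg0 muln0.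
Qed.

Lemma admissibleC a : admissible 0 0 (a%:MP)%:P.
Proof.
split; last by exists a%:P; rewrite thetaC mmapC.
by apply: coef_supportedC; apply: supportedC; rewrite /weight_le mdeg0 muln0.
Qed.

Lemma admissibleZ (i : 'I_k) : admissible d 0 ('X_(lift ord_max i))%:P.
Proof.
split.
  by apply: coef_supportedC; apply: supportedX; rewrite /weight_le mdeg1 muln1 addn0.
exists 0; rewrite thetaC mmapX mmap1U eq_sym (negbTE (neq_lift _ _)) //.
Qed.

(** The power of [X] clears the denominators that arise when y_i^d is solved for. *)
Definition reducible_to (M : nat) (r : {poly Y}) := exists N (c : box -> {poly Z}),
  'X^N * r = \sum_b ev (c b) * ('X_[mbox b])%:P /\
  forall b, admissible M (mdeg (mbox b)) (c b).

Lemma reducible_le M M' r : (M <= M')%N -> reducible_to M r -> reducible_to M' r.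
Proof.
move=> leM [N [c [hr hc]]]; exists N, c; split=> // b.
have [h ?] := hc b; split=> //; apply: coef_supportedW h => mu.
rewrite /weight_le; lia.
Qed.

Lemma reducible0 M : reducible_to M 0.
Proof.
exists 0%N, (fun _ => 0); split; last by move=> b; exact: admissible0.
by rewrite mulr0 big1 // => b _; rewrite rmorph0 mul0r.
Qed.

Lemma reducibleM M M' e r :
  admissible M' 0 e -> reducible_to M r -> reducible_to (M' + M) (ev e * r).
Proof.
move=> he [N [c [hr hc]]]; exists N, (fun b => e * c b); split; last first.
  by move=> b; rewrite -[mdeg _]add0n; exact: admissibleM.
rewrite mulrCA hr mulr_sumr; apply: eq_bigr => b _.
by rewrite rmorphM mulrA.
Qed.

Lemma evXn N : ev 'X^N = 'X^N.
Proof. by rewrite rmorphXn evX. Qed.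

Lemma reducibleD M r r' :
  reducible_to M r -> reducible_to M r' -> reducible_to M (r + r').
Proof.
move=> [N [c [hr hc]]] [N' [c' [hr' hc']]].
exists (N + N')%N, (fun b => 'X^N' * c b + 'X^N * c' b); split; last first.
  move=> b; apply: admissibleD; rewrite -[M]add0n -[mdeg _]add0n;
    by apply: admissibleM => //; exact: admissibleXn.
rewrite mulrDr {1}addnC !exprD -!mulrA hr hr' !mulr_sumr -big_split /=.
apply: eq_bigr => b _.
by rewrite rmorphD !rmorphM !evXn mulrDl !mulrA.
Qed.

Lemma reducible_sum (I : Type) (s : seq I) (S : pred I) (F : I -> {poly Y}) M :
  (forall i, S i -> reducible_to M (F i)) ->
  reducible_to M (\sum_(i <- s | S i) F i).
Proof.
by move=> hF; elim/big_rec: _ => [|i r Si hr];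
  [exact: reducible0 | apply: reducibleD => //; exact: hF].
Qed.

Lemma reducibleX M r : reducible_to M ('X * r) -> reducible_to M r.
Proof.
by move=> [N [c [hr hc]]]; exists N.+1, c; split=> //; rewrite exprSr -mulrA.
Qed.

Lemma reducible_from_monomials M :
  (forall m : 'X_{1..k}, (mdeg m <= M)%N -> reducible_to (mdeg m) ('X_[m])%:P) ->
  forall q : Y, (msize q <= M.+1)%N -> reducible_to M q%:P.
Proof.
move=> hM q hq; rewrite [q]mpolyE raddf_sum big_seq; apply: reducible_sum => m hm.
have dm : (mdeg m <= M)%N by have := msize_mdeg_lt hm; lia.
have := reducibleM (admissibleC q@_m) (hM m dm).
rewrite add0n evC mmapC /= -polyCM mul_mpolyC.
by apply: reducible_le.
Qed.

(* [X * y_i^d = h'_i - h_i] trades a monomial of degree [d] for the perturbed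
   polynomial [h'_i] and terms of degree less than [d]. *)
Lemma reducible_monomial (m : 'X_{1..k}) : reducible_to (mdeg m) ('X_[m])%:P.
Proof.
have [M] := ubnP (mdeg m); elim: M m => // M IH m; rewrite ltnS => leM.
have [/forallP mlt|] := boolP [forall i, (m i < d)%N].
  pose b0 : box := [ffun i => Ordinal (mlt i)].
  have eb0 : mbox b0 = m by apply/mnmP => i; rewrite mnmE ffunE.
  exists 0%N, (fun b => if b == b0 then 1 else 0); split.
    rewrite mul1r (bigD1 b0) //= big1 ?addr0 => [|b /negbTE->].
      by rewrite eqxx rmorph1 mul1r eb0.
    by rewrite rmorph0 mul0r.
  move=> b; case: eqP => [->|_]; last exact: admissible0.
  split; last by exists 1; rewrite rmorph1.
  by apply: coef_supportedC; apply: supportedC; rewrite /weight_le mdeg0 muln0 eb0.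
rewrite negb_forall => /existsP[i]; rewrite -leqNgt => dmi.
pose m' := (m - U_(i) *+ d)%MM.
have em : m = (m' + U_(i) *+ d)%MM.
  rewrite /m' submK //; apply/mnm_lepP => j; rewrite mulmnE mnm1E.
  by case: eqP => [<-|_]; rewrite ?mul1n ?mul0n.
have dm : mdeg m = (mdeg m' + d)%N by rewrite em mdegD mdegMn mdeg1 mul1n.
apply: reducibleX.
have -> : 'X * ('X_[m])%:P =
    ev ('X_(lift ord_max i))%:P * ('X_[m'])%:P
    + ev ((-1)%:MP)%:P * ('X_[m'] * p (lift ord_max i))%:P.
  rewrite !evC mmapX mmap1U mmapC /perturbed liftK em mpolyXD -mpolyXn.
  rewrite /= mpolyCN mpolyC1 !polyCN !polyCM polyC1; ring.
have lt_m : (mdeg m' < M)%N by lia.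
apply: reducibleD.
  by rewrite dm addnC; apply: reducibleM (admissibleZ i) (IH _ _).
rewrite -[mdeg m]add0n; apply: reducibleM; first exact: admissibleC.
(* Since [p] has degree at most [d.-1], the monomials of the correction term have smaller degree
   than [m], and induction applies to them. *)
apply: (@reducible_le (mdeg m' + d.-1)%N); first by lia.
apply: reducible_from_monomials => [m1 hm1|]; first by apply: IH; lia.
have [->|nz] := eqVneq (p (lift ord_max i)) 0; first by rewrite mulr0 mmeasure0.
have nzX : 'X_[m'] != 0 :> Y by rewrite -msize_poly_eq0 msizeX.
rewrite msizeM // msizeX.
by have := p_size (lift ord_max i); move: (msize _) d_gt0 => sz; lia.
Qed.

Lemma reducible_mul_last : exists N (C : box -> box -> {poly Z}),
  forall a,
    'X^N * ((p ord_max)%:P * ('X_[mbox a])%:P) = \sum_b ev (C a b) * ('X_[mbox b])%:P /\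
    forall b, admissible (d + mdeg (mbox a)) (mdeg (mbox b)) (C a b).
Proof.
have red a : reducible_to (d + mdeg (mbox a)) ((p ord_max)%:P * ('X_[mbox a])%:P).
  rewrite -polyCM; apply: reducible_from_monomials => [m _|].
    exact: reducible_monomial.
  have [->|nz] := eqVneq (p ord_max) 0; first by rewrite mul0r mmeasure0.
  have nzX : 'X_[mbox a] != 0 :> Y by rewrite -msize_poly_eq0 msizeX.
  rewrite msizeM // msizeX.
  by have := p_size ord_max; move: (msize _) d_gt0 => sz; lia.
have [N /fin_all_exists[C hC]] := fin_all_exists red.
(* One power of [X] has to serve all rows: the sum of the exponents, the missing factors being moved
   into [C]. *)
exists (\sum_a N a)%N, (fun a b => 'X^(\sum_(a' | a' != a) N a') * C a b) => a.
have [hr hc] := hC a; split; last first.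
  move=> b; rewrite -[X in admissible X]add0n -[mdeg (mbox b)]add0n.
  by apply: admissibleM => //; exact: admissibleXn.
rewrite (bigD1 a) //= addnC exprD -mulrA hr mulr_sumr; apply: eq_bigr => b _.
by rewrite rmorphM evXn mulrA.
Qed.

End Reduction.

Section Perron.
Variables (A : idomainType) (k d : nat) (p : 'I_k.+1 -> {mpoly A[k]}).
Hypotheses (d_gt0 : (0 < d)%N) (p_size : forall l, (msize (p l) <= d)%N).

Let Y := {mpoly A[k]}.
Let Z := {mpoly A[k.+1]}.

Lemma lowest_coefficient (D : {poly Z}) :
  D != 0 -> exists j (c : {poly Z}), D = c * 'X^j /\ c`_0 = D`_j /\ D`_j != 0.
Proof.
move=> nzD; have exj : exists j, D`_j != 0.
  by exists (size D).-1; rewrite -lead_coefE lead_coef_eq0.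
pose j := ex_minn exj; exists j, (drop_poly j D).
rewrite /j; case: ex_minnP => {}j nzj minj; rewrite coef_drop_poly add0n.
split=> //; rewrite -{1}(poly_take_drop j D).
suff -> : take_poly j D = 0 by rewrite add0r.
apply/polyP => i; rewrite coef_take_poly coef0; case: ltnP => // ij.
by apply: contraTeq ij => /minj; rewrite -leqNgt.
Qed.

(* Multiplication by [X^N h] acts on the monomials [y^a], [a_i < d], through a
   matrix of polynomials in the perturbed [h'_i]; its characteristic polynomial
   annihilates [X^N h], and the lowest coefficient in [X] of this relation is a
   relation between the unperturbed polynomials. *)
Theorem perron_relation : exists Q : {mpoly A[k.+1]},
  [/\ Q != 0, supported (fun mu => (mdeg mu <= d ^ k)%N) Q
    & mmap (@mpolyC k A) p Q = 0].
Proof.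
pose ev : {rmorphism {poly Z} -> {poly Y}} :=
  horner_eval 'X \o map_poly (mmap (@polyC _ \o @mpolyC k A) (perturbed d p)).
pose theta : {rmorphism {poly Z} -> {poly {poly A}}} :=
  horner_eval ('X%:P) \o
  map_poly (mmap (@polyC _ \o @polyC A)
                 (fun l : 'I_k.+1 => if l == ord_max then 'X else 0)).
have evC q : ev q%:P = mmap (@polyC _ \o @mpolyC k A) (perturbed d p) q.
  by rewrite /ev /= map_polyC /= /horner_eval hornerC.
have evX : ev 'X = 'X by rewrite /ev /= map_polyX /= /horner_eval hornerX.
have thetaC q : theta q%:P = mmap (@polyC _ \o @polyC A)
    (fun l : 'I_k.+1 => if l == ord_max then 'X else 0) q.
  by rewrite /theta /= map_polyC /= /horner_eval hornerC.
have thetaX : theta 'X = 'X%:P.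
  by rewrite /theta /= map_polyX /= /horner_eval hornerX.
clearbody ev theta.
have [N [C hC]] := reducible_mul_last d_gt0 p_size evC evX thetaC thetaX.
pose n := #|{ffun 'I_k -> 'I_d}|.
pose mon (b : {ffun 'I_k -> 'I_d}) : 'X_{1..k} := [multinom (b i : nat) | i < k].
pose z : {poly Z} := 'X^N * ('X_ord_max)%:P.
pose M : 'M[{poly Z}]_n := z%:M - \matrix_(a, b) C (enum_val a) (enum_val b).
have evz : ev z = 'X^N * (p ord_max)%:P.
  rewrite rmorphM rmorphXn evX evC mmapX mmap1U /perturbed.
  by rewrite unlift_none addr0.
have evdet : ev (\det M) = 0.
  pose v : 'cV[{poly Y}]_n := \col_a ('X_[mon (enum_val a)])%:P.
  have Mv : map_mx ev M *m v = 0.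
    apply/matrixP => a j; rewrite !mxE.
    under eq_bigr => b _ do rewrite !mxE rmorphB rmorphMn mulrBl.
    rewrite big_split /= (bigD1 a) //= big1 => [|b /negbTE nb].
      rewrite eqxx mulr1n addr0 evz -mulrA (proj1 (hC _)).
      rewrite (big_enum_val (fun b => ev (C (enum_val a) b) * ('X_[mon b])%:P)) /=.
      by rewrite -big_split /= big1 // => b _; rewrite subrr.
    by rewrite eq_sym nb mulr0n mul0r.
  (* The vector [v] of box monomials is in the kernel, so by the adjugate the determinant kills it;
     its entry at exponent 0 is 1. *)
  have /matrixP : \det (map_mx ev M) *: v = 0.
    by rewrite -mul_scalar_mx -mul_adj_mx -mulmxA Mv mulmx0.
  pose b0 : {ffun 'I_k -> 'I_d} := [ffun => Ordinal d_gt0].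
  move=> /(_ (enum_rank b0) 0); rewrite !mxE enum_rankK det_map_mx.
  have -> : mon b0 = 0%MM by apply/mnmP => i; rewrite mnmE ffunE mnm0E.
  by rewrite mpolyX0 mulr1.
(* The entries of [C] become constant in the outer indeterminate, so the determinant becomes a
   characteristic polynomial, which is monic, composed with a polynomial of degree 1. *)
have thetadet : theta (\det M) != 0.
  pose E : 'M[{poly A}]_n := \matrix_(a, b) (theta (C (enum_val a) (enum_val b)))`_0.
  pose s : {poly {poly A}} := ('X^N)%:P * 'X.
  have szs : size s = 2.
    by rewrite size_Cmul ?size_polyX // -size_poly_eq0 size_polyXn.
  have -> : theta (\det M) = char_poly E \Po s.
    rewrite /char_poly -!det_map_mx; congr (\det _).
    apply/matrixP => a b; rewrite !mxE !rmorphB !rmorphMn; congr (_ - _).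
      rewrite rmorphM rmorphXn thetaX thetaC mmapX mmap1U eqxx.
      by rewrite /= comp_polyX /s polyC_exp.
    have [e he] := proj2 (proj2 (hC (enum_val a)) (enum_val b)).
    by rewrite he /= comp_polyC coefC eqxx.
  rewrite comp_poly_eq0 ?szs // -size_poly_eq0 size_char_poly //.
(* The entry (a, b) has weight at most [d + t a - t b]. Along a permutation the [t] cancel, leaving
   weight [n * d], that is degree n = d^k. *)
have degdet : coef_supported (fun mu => (mdeg mu <= d ^ k)%N) (\det M).
  pose t (a : 'I_n) := mdeg (mon (enum_val a)).
  have hM a b : coef_supported (weight_le d (d + t a) (t b)) (M a b).
    rewrite !mxE; apply: coef_supportedD; last first.
      move=> j mu; rewrite coefN (perm_mem (msuppN _)).
      exact: (proj1 (proj2 (hC _) _)).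
    case: eqP => [->|_]; last exact: coef_supported0.
    rewrite mulr1n; apply: (@coef_supportedM _ _ (eq 0%MM) (eq U_(ord_max)%MM)).
    - by move=> _ _ <- <-; rewrite add0m /weight_le mdeg1 muln1.
    - exact: coef_supportedXn.
    - by apply: coef_supportedC; apply: supportedX.
  apply: coef_supported_sum => /= s _.
  apply: (@coef_supportedM _ _ (eq 0%MM)
    (weight_le d (\sum_a (d + t a)) (\sum_a t (s a)))).
  - move=> _ nu <-; rewrite add0m /weight_le big_split /= sum_nat_const card_ord.
    rewrite [X in (_ + X <= _)%N](_ : _ = \sum_a t a)%N; last first.
      by rewrite [RHS](reindex_inj (@perm_inj _ s)).
    rewrite leq_add2r /n card_ffun !card_ord mulnC leq_pmul2r //.
  - case: (odd_perm s); rewrite ?expr0 ?expr1.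
      move=> j mu; rewrite coefN (perm_mem (msuppN _)).
      by move: j mu; apply: (@coef_supportedXn _ _ _ 0).
    by apply: (@coef_supportedXn _ _ _ 0).
  - elim/big_rec3: _ => [|a u w q _ IH].
      by apply: (@coef_supportedXn _ _ _ 0); rewrite /weight_le mdeg0 muln0.
    apply: coef_supportedM (hM a (s a)) IH => mu nu; exact: weight_leD.
have nzdet : \det M != 0.
  by apply: contraNneq thetadet => ->; rewrite rmorph0.
have [j [c [ec [c0 nzc]]]] := lowest_coefficient nzdet.
have evc : ev c = 0.
  apply/eqP; move/eqP: evdet; rewrite ec rmorphM rmorphXn evX mulf_eq0.
  by rewrite expf_eq0 polyX_eq0 andbF orbF.
exists c`_0; rewrite c0; split=> //; rewrite -c0.
(* At [X = 0] the perturbed polynomials are again the [p l], and only the constant coefficient of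
   [c] remains. *)
have : (ev c).[0] = 0 by rewrite evc horner0.
rewrite -{1}(poly_take_drop 1 c) rmorphD rmorphM rmorphXn evX hornerD.
rewrite hornerM expr1 hornerX mulr0 addr0.
have -> : take_poly 1 c = (c`_0)%:P.
  by apply/polyP => i; rewrite coef_take_poly coefC; case: i.
rewrite evC -[_.[0]]/(horner_eval 0 _) rmorph_mmap => h0.
rewrite -[RHS]h0 /mmap; apply: eq_bigr => m _; congr (_ * _).
  by rewrite /= /horner_eval hornerC.
apply: mmap1_eq => l /=; rewrite /horner_eval /perturbed hornerD hornerC.
by case: (unlift _ _) => [i|]; rewrite ?hornerM ?hornerX ?mul0r ?horner0 addr0.
Qed.

End Perron.

(** * The Schwartz-Zippel bound *)

Section SchwartzZippel.
Variables (A : idomainType) (T : finType).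

Lemma card_roots (q : {poly A}) (u : T -> A) :
  injective u -> q != 0 -> (#|[set t | q.[u t] == 0%R]| < size q)%N.
Proof.
move=> inj_u nzq; rewrite cardE -(size_map u).
apply: max_poly_roots => //; last by rewrite map_inj_uniq // enum_uniq.
by apply/allP => _ /mapP[t ht ->]; rewrite mem_enum inE in ht.
Qed.

Variable k : nat.
Implicit Types (Q : {mpoly A[k.+1]}) (m : 'X_{1..k.+1}).

Let low m : 'X_{1..k} := [multinom m (widen_ord (leqnSn k) i) | i < k].

Lemma mdeg_low m : mdeg m = (mdeg (low m) + m ord_max)%N.
Proof.
rewrite !mdegE big_ord_recr /=; congr (_ + _)%N.
by apply: eq_bigr => i _; rewrite mnmE.
Qed.

Lemma low_inj m m' : low m = low m' -> m ord_max = m' ord_max -> m = m'.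
Proof.
move=> /mnmP hl hm; apply/mnmP => i; case: (unliftP ord_max i) => [j|] -> //.
have -> : lift ord_max j = widen_ord (leqnSn k) j.
  by apply: val_inj; rewrite /= /bump leqNgt ltn_ord.
by have := hl j; rewrite !mnmE.
Qed.

Lemma supported_muni_coef Q e r :
  supported (fun mu => (mdeg mu <= e)%N) Q ->
  supported (fun mu => (mdeg mu + r <= e)%N) (muni Q)`_r.
Proof.
move=> hQ; rewrite muniE coef_sum big_seq; apply: supported_sum => m hm.
rewrite coefZ coefXn; case: eqP => [er|_]; last first.
  by rewrite mulr0; exact: supported0.
rewrite mulr1; apply: supportedZ; apply: supportedX.
by have := hQ _ hm; rewrite mdeg_low er.
Qed.

Lemma muni_neq0 Q : Q != 0 -> muni Q != 0.
Proof.
rewrite -msupp_eq0; case E: (msupp Q) => [//|m s] _.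
have hm : m \in msupp Q by rewrite E inE eqxx.
apply/eqP => /(congr1 (fun q : {poly {mpoly A[k]}} => (q`_(m ord_max))@_(low m))).
rewrite coef0 mcoeff0 muniE coef_sum raddf_sum /=.
rewrite (bigD1_seq m) //= ?msupp_uniq // coefZ coefXn eqxx mulr1 mcoeffZ mcoeffX.
rewrite eqxx mulr1 big1 ?addr0 => [|m' nm].
  by apply/eqP; rewrite -mcoeff_msupp.
rewrite coefZ coefXn; case: eqP => [em|_]; last by rewrite mulr0 mcoeff0.
rewrite mulr1 mcoeffZ mcoeffX; case: eqP => [el|_]; last by rewrite mulr0.
by case/eqP: nm; exact: low_inj.
Qed.

Lemma meval_muni Q (x : 'I_k.+1 -> A) :
  Q.@[x] = (map_poly (meval (fun i => x (lift ord_max i))) (muni Q)).[x ord_max].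
Proof.
rewrite muniE rmorph_sum horner_sum mevalE; apply: eq_bigr => m _ /=.
rewrite map_polyZ /= mevalZ mevalX map_polyXn hornerZ hornerXn -mulrA.
rewrite big_ord_recr /=; congr (_ * (_ * _)); apply: eq_bigr => i _.
rewrite mnmE; congr (x _ ^+ _); apply: val_inj.
by rewrite /= /bump leqNgt ltn_ord.
Qed.

End SchwartzZippel.

(** Induction on [k]: if [Q] has degree r in its last variable, the leading coefficient [L] has
    degree at most e - r. Where [L] vanishes all values of the last coordinate are counted,
    elsewhere at most r. Each coordinate has its own injection [u l], because the forms substituted
    later depend on [l]. *)
Lemma schwartz_zippel (A : idomainType) (T : finType) (k e : nat)
    (Q : {mpoly A[k]}) (u : 'I_k -> T -> A) :
  (forall l, injective (u l)) -> Q != 0 ->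
  supported (fun mu => (mdeg mu <= e)%N) Q ->
  (#|[set tau : {ffun 'I_k -> T} | Q.@[fun l => u l (tau l)] == 0%R]| * #|T|
     <= e * #|T| ^ k)%N.
Proof.
elim: k e Q u => [|k IH] e Q u inj_u nzQ degQ.
  set S := [set tau | _]; suff -> : S = set0 by rewrite cards0.
  apply/setP => tau; rewrite !inE.
  move: nzQ; rewrite (nvar0_mpolyC Q) mpolyC_eq0 mevalC => /negbTE -> //.
pose q := muni Q; have nzq : q != 0 by exact: muni_neq0.
pose r := (size q).-1; pose L := q`_r.
have nzL : L != 0 by rewrite /L /r -lead_coefE lead_coef_eq0.
have degL : supported (fun mu => (mdeg mu <= e - r)%N) L.
  by apply: supportedW (supported_muni_coef (r := r) degQ) => mu; lia.
have le_r_e : (r <= e)%N.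
  move: nzL; rewrite -msupp_eq0; case E: (msupp L) => [//|mu s] _.
  have /(supported_muni_coef (r := r) degQ) : mu \in msupp L by rewrite E inE eqxx.
  by lia.
pose u' (l : 'I_k) := u (lift ord_max l).
have IHL := IH _ _ u' (fun l => inj_u _) nzL degL.
pose join (x : {ffun 'I_k -> T} * T) : {ffun 'I_k.+1 -> T} :=
  [ffun l => if unlift ord_max l is Some i then x.1 i else x.2].
pose split (tau : {ffun 'I_k.+1 -> T}) :=
  ([ffun i => tau (lift ord_max i)] : {ffun 'I_k -> T}, tau ord_max).
have joinK : cancel join split.
  move=> [x t]; rewrite /split /join ffunE unlift_none; congr (_, _).
  by apply/ffunP => i; rewrite !ffunE liftK.
have splitK : cancel split join.
  move=> tau; apply/ffunP => l; rewrite ffunE.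
  by case: unliftP => [i|] -> //=; rewrite ffunE.
have evQ x t : Q.@[fun l => u l (join (x, t) l)] =
    (map_poly (meval (fun i => u' i (x i))) q).[u ord_max t].
  rewrite meval_muni ffunE unlift_none; congr (_.[_]).
  by apply: eq_map_poly => c; apply: meval_eq => i; rewrite ffunE liftK.
rewrite -sum1dep_card (reindex join) /=; last first.
  by exists split => x _; [exact: joinK | exact: splitK].
pose bad (x : {ffun 'I_k -> T}) (t : T) :=
  (map_poly (meval (fun i => u' i (x i))) q).[u ord_max t] == 0.
rewrite (eq_bigl (fun x : {ffun 'I_k -> T} * T => predT x.1 && bad x.1 x.2));
  last by case=> x t; rewrite evQ.
rewrite -(pair_big_dep predT bad (fun _ _ => 1%N)) /=.
apply: (@leq_trans ((\sum_(x : {ffun 'I_k -> T})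
   (if L.@[fun i => u' i (x i)] == 0%R then #|T| else r)) * #|T|)).
  rewrite leq_mul2r; apply/orP; right; apply: leq_sum => x _.
  rewrite sum1dep_card; case: ifP => [_|nz]; first exact: max_card.
  have szx : size (map_poly (meval (fun i => u' i (x i))) q) = size q.
    by apply: size_map_poly_id0; rewrite lead_coefE nz.
  have := @card_roots A T (map_poly (meval (fun i => u' i (x i))) q) _ (inj_u ord_max).
  rewrite -size_poly_eq0 szx size_poly_eq0 => /(_ nzq).
  by rewrite (polySpred nzq) ltnS.
rewrite big_if /= sum_nat_const sum_nat_const.
rewrite [X in (X + _)%N](_ : _ =
  (#|[set x : {ffun 'I_k -> T} | L.@[fun i => u' i (x i)] == 0%R]| * #|T|)%N); last first.
  by rewrite cardsE.
rewrite mulnDl; apply: (@leq_trans ((e - r) * #|T| ^ k * #|T| + #|T| ^ k * r * #|T|)%N).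
  rewrite leq_add ?leq_mul2r ?IHL ?orbT //.
  apply/orP; right; apply/orP; right.
  by apply: leq_trans (max_card _) _; rewrite card_ffun card_ord.
rewrite expnSr [(#|T| ^ k * r)%N]mulnC -mulnDl -mulnDl subnK // mulnA //.
Qed.

(** * Ideals containing binary forms *)

Section Ideal.
Variables (K : comNzRingType) (N r : nat) (G : 'I_r -> {mpoly K[N]}).
Implicit Types p q : {mpoly K[N]}.

Definition in_ideal p := exists q : 'I_r -> {mpoly K[N]}, p = \sum_l q l * G l.

Lemma in_ideal0 : in_ideal 0.
Proof. by exists (fun _ => 0); rewrite big1 // => l _; rewrite mul0r. Qed.

Lemma in_idealD p q : in_ideal p -> in_ideal q -> in_ideal (p + q).
Proof.
move=> [p' ->] [q' ->]; exists (fun l => p' l + q' l).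
by rewrite -big_split; apply: eq_bigr => l _; rewrite mulrDl.
Qed.

Lemma in_idealMl p q : in_ideal q -> in_ideal (p * q).
Proof.
move=> [q' ->]; exists (fun l => p * q' l).
by rewrite mulr_sumr; apply: eq_bigr => l _; rewrite mulrA.
Qed.

Lemma in_ideal_sum (I : Type) (s : seq I) (S : pred I) (F : I -> {mpoly K[N]}) :
  (forall i, S i -> in_ideal (F i)) -> in_ideal (\sum_(i <- s | S i) F i).
Proof.
by move=> hF; elim/big_rec: _ => [|i p Si hp];
  [exact: in_ideal0 | apply: in_idealD => //; exact: hF].
Qed.

Lemma in_ideal_gen l : in_ideal (G l).
Proof.
exists (fun l' => (l' == l)%:R); rewrite (bigD1 l) //= eqxx mul1r big1 ?addr0 //.
by move=> l' /negbTE->; rewrite mul0r.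
Qed.

Lemma mcoeff_pihomog D p m :
  (pihomog mdeg D p)@_m = if mdeg m == D then p@_m else 0.
Proof.
rewrite pihomogE raddf_sum /=; case: ifP => [hm|nm].
  have [hs|ns] := boolP (m \in msupp p).
    rewrite -big_filter (bigD1_seq m) ?filter_uniq ?msupp_uniq //=; last first.
      by rewrite mem_filter hm hs.
    rewrite mcoeffZ mcoeffX eqxx mulr1 big1 ?addr0 // => m' nm'.
    by rewrite mcoeffZ mcoeffX (negbTE nm') mulr0.
  rewrite memN_msupp_eq0 // big_seq_cond big1 // => m' /andP[hm' _].
  rewrite mcoeffZ mcoeffX; case: eqP => [e|_]; last by rewrite mulr0.
  by rewrite -e hm' in ns.
rewrite big1 // => m' hm'; rewrite mcoeffZ mcoeffX; case: eqP => [e|_].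
  by rewrite -e hm' in nm.
by rewrite mulr0.
Qed.

(** After expanding the multipliers into monomials, every summand is homogeneous, and the projection
    keeps it or kills it. *)
Lemma in_ideal_pihomog (g D : nat) p :
  (forall l, G l \is g.-homog) -> in_ideal p -> in_ideal (pihomog mdeg D p).
Proof.
move=> hG [q ->]; rewrite raddf_sum; apply: in_ideal_sum => l _ /=.
rewrite [q l]mpolyE mulr_suml raddf_sum; apply: in_ideal_sum => m _ /=.
rewrite -scalerAl linearZ /= -mul_mpolyC; apply: in_idealMl.
have hom : 'X_[m] * G l \is (mdeg m + g).-homog.
  by apply: dhomogM => //; rewrite dhomogX.
have [<-|ne] := eqVneq (mdeg m + g)%N D.
  by rewrite pihomog_dE //; apply: in_idealMl; exact: in_ideal_gen.
by rewrite (pihomog_ne0 ne hom); exact: in_ideal0.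
Qed.

Lemma dhomog_exponentE D p : p \is D.-homog ->
  p = \sum_(a : {a : 'X_{1..N < D.+1} | mdeg a == D}) p@_(val a) *: 'X_[val a].
Proof.
move=> hp; apply/mpolyP => m; rewrite raddf_sum /=.
have [hm|nm] := eqVneq (mdeg m) D; last first.
  rewrite -(pihomog_dE hp) mcoeff_pihomog (negbTE nm) big1 // => a _.
  rewrite mcoeffZ mcoeffX; case: eqP => [e|_]; last by rewrite mulr0.
  by case/eqP: nm; rewrite -e; exact/eqP/(valP a).
have hm1 : (mdeg m < D.+1)%N by rewrite hm.
have hm2 : mdeg (BMultinom hm1) == D by rewrite /= hm.
pose a0 : {a : 'X_{1..N < D.+1} | mdeg a == D} := Sub (BMultinom hm1) hm2.
rewrite (bigD1 a0) //= mcoeffZ mcoeffX eqxx mulr1 big1 ?addr0 // => a na.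
rewrite mcoeffZ mcoeffX; case: eqP => [e|_]; last by rewrite mulr0.
by case/eqP: na; apply/val_inj/val_inj.
Qed.

End Ideal.

Definition binary (K : comNzRingType) (N : nat) (i j : 'I_N) (P : {mpoly K[N]}) :=
  supported (fun mu => forall l, l != i -> l != j -> mu l = 0%N) P.

(** * Bounding the quotient by an ideal with binary forms in all pairs of variables *)

Section Reduction.
Variables (F : fieldType) (n r g : nat) (G : 'I_r -> {mpoly F[n.+1]}).
Hypothesis hG : forall l, G l \is g.-homog.
Hypothesis hP : forall i j : 'I_n.+1, (i < j)%N ->
  exists P : {mpoly F[n.+1]}, [/\ P != 0, binary i j P & in_ideal G P].

(** An additive weight, strictly decreasing in the index of the variable: it separates the monomials
    of one degree in any two given variables, and so replaces a monomial order. *)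
Let wt (m : 'X_{1..n.+1}) := (\sum_(l < n.+1) (n - l) * m l)%N.

Lemma wtD m m' : wt (m + m')%MM = (wt m + wt m')%N.
Proof. by rewrite /wt -big_split; apply: eq_bigr => l _; rewrite mnmDE mulnDr. Qed.

(** The ideal is graded, so it contains the component of [P] in the degree of the leading monomial,
    and this component is nonzero. *)
Lemma homogeneous_binary (i j : 'I_n.+1) : (i < j)%N ->
  exists (e : nat) (P : {mpoly F[n.+1]}),
  [/\ P != 0, P \is e.-homog, binary i j P & in_ideal G P].
Proof.
move=> ij; have [P [nzP binP idP]] := hP ij.
have hm : mlead P \in msupp P by exact: mlead_supp.
exists (mdeg (mlead P)), (pihomog mdeg (mdeg (mlead P)) P); split.
- apply: contraTneq hm => /(congr1 (mcoeff (mlead P))).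
  by rewrite mcoeff_pihomog eqxx mcoeff0 mcoeff_msupp => ->; rewrite eqxx.
- exact: pihomogP.
- move=> mu; rewrite mcoeff_msupp mcoeff_pihomog; case: ifP; rewrite ?eqxx // => _.
  by rewrite -mcoeff_msupp => /binP.
- exact: in_ideal_pihomog hG idP.
Qed.

(** Dividing a binary form by the coefficient of its heaviest monomial leaves strictly lighter
    terms; [e] is the maximum of the degrees over all pairs. *)
Lemma leading_monomial : exists e, forall i j : 'I_n.+1, (i < j)%N ->
  exists (m0 : 'X_{1..n.+1}) (Q : {mpoly F[n.+1]}),
  [/\ forall l, (m0 l <= if (l == i) || (l == j) then e else 0)%N,
      in_ideal G ('X_[m0] + Q) &
      supported (fun mu => mdeg mu = mdeg m0 /\ wt mu < wt m0)%N Q].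
Proof.
pose Pr (x : 'I_n.+1 * 'I_n.+1) e := (x.1 < x.2)%N ->
  exists (m0 : 'X_{1..n.+1}) (Q : {mpoly F[n.+1]}),
  [/\ forall l, (m0 l <= if (l == x.1) || (l == x.2) then e else 0)%N,
      in_ideal G ('X_[m0] + Q) &
      supported (fun mu => mdeg mu = mdeg m0 /\ wt mu < wt m0)%N Q].
have /fin_all_exists[e he] : forall x, exists e, Pr x e; last first.
  exists (\max_x e x)%N => i j ij; have [m0 [Q [h1 h2 h3]]] := he (i, j) ij.
  exists m0, Q; split=> // l; apply: leq_trans (h1 l) _ => /=.
  by case: ifP => // _; apply: leq_bigmax.
move=> [i j]; rewrite /Pr /=; have [ij|ji] := ltnP i j; last first.
  by exists 0%N => lt_ij; lia.
have [e [P [nzP homP binP idP]]] := homogeneous_binary ij.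
exists e => _.
have degP m : m \in msupp P -> mdeg m = e by move=> hm; rewrite (dhomog_mf homP hm).
have [m0 hm0 maxm0] : exists2 m0, m0 \in msupp P &
    forall m, m \in msupp P -> (wt m <= wt m0)%N.
  have : msupp P != [::] by rewrite msupp_eq0.
  elim: (msupp P) => // m [|m1 s] IH _.
    by exists m => [|m']; rewrite inE ?eqxx // => /eqP->.
  have [//|m0 hm0 hmax] := IH.
  have [le|lt] := leqP (wt m) (wt m0).
    exists m0; first by rewrite inE hm0 orbT.
    by move=> m'; rewrite inE => /orP[/eqP->|/hmax].
  exists m => [|m']; first by rewrite inE eqxx.
  rewrite inE => /orP[/eqP->|/hmax h] //; exact: leq_trans h (ltnW lt).
have nzc : P@_m0 != 0 by rewrite -mcoeff_msupp.
pose Q := (P@_m0)^-1 *: P - 'X_[m0].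
exists m0, Q; split.
- move=> l; case: ifP => [_|/norP[li lj]]; last by rewrite (binP _ hm0).
  by rewrite -(degP _ hm0) mdegE (bigD1 l) //= leq_addr.
- by rewrite /Q addrC subrK -mul_mpolyC; exact: in_idealMl.
move=> m; rewrite mcoeff_msupp /Q mcoeffB mcoeffZ mcoeffX.
have [<-|nm] := eqVneq m0 m; first by rewrite mulVf // subrr eqxx.
rewrite subr0 mulf_eq0 invr_eq0 (negbTE nzc) /= -mcoeff_msupp => hm.
rewrite (degP _ hm0) (degP _ hm); split=> //.
rewrite ltn_neqAle maxm0 // andbT; apply: contra nm => /eqP ewt.
have ne_ij : j != i by rewrite -val_eqE /= gtn_eqF.
have two (w : 'I_n.+1 -> nat) m' : m' \in msupp P ->
    (\sum_(l < n.+1) w l * m' l = w i * m' i + w j * m' j)%N.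
  move=> hm'; rewrite (bigD1 i) //= (bigD1 j) //= big1 ?addn0 // => l /andP[li lj].
  by rewrite (binP _ hm') // muln0.
have edeg : (m i + m j = m0 i + m0 j)%N.
  have := degP _ hm; rewrite -(degP _ hm0) !mdegE.
  under eq_bigr => l _ do rewrite -[m l]mul1n.
  under [RHS]eq_bigr => l _ do rewrite -[m0 l]mul1n.
  by rewrite !(two (fun _ => 1%N)) // !mul1n.
move: ewt; rewrite /wt !(two (fun l => n - l)%N) // => ewt.
have lt_jn := ltn_ord j; rewrite ltnS in lt_jn.
(* Subtracting n - j times the common degree from the weight leaves (j - i) times the exponent of
   x_i, and j > i. *)
have eij : m i = m0 i.
  have en : (n - i = (n - j) + (j - i))%N by lia.
  rewrite en !mulnDl in ewt.
  have e1 : ((n - j) * m i + (n - j) * m j = (n - j) * m0 i + (n - j) * m0 j)%N.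
    by rewrite -!mulnDr edeg.
  have e2 : ((j - i) * m i = (j - i) * m0 i)%N by lia.
  by apply/eqP; rewrite -(eqn_pmul2l (m := j - i)) ?subn_gt0 // e2.
apply/eqP/mnmP => l; have [->|li] := eqVneq l i; first by [].
have [->|lj] := eqVneq l j; first by lia.
by rewrite (binP _ hm) // (binP _ hm0).
Qed.

(* Modulo the ideal every form of degree [D] is a combination of monomials with
   at most one exponent [>= e]; the number of these does not depend on [D]. *)
Definition tall_monomial (e D : nat) (x : 'I_n.+1 * {ffun 'I_n.+1 -> 'I_e}) :
    'X_{1..n.+1} :=
  [multinom if l == x.1 then D - \sum_(l' | l' != x.1) x.2 l' else x.2 l | l < n.+1]%N.

Definition spanned (e D : nat) (p : {mpoly F[n.+1]}) :=
  exists c : 'I_n.+1 * {ffun 'I_n.+1 -> 'I_e} -> F,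
    in_ideal G (p - \sum_x c x *: 'X_[tall_monomial D x]).

Lemma spannedD e D p q : spanned e D p -> spanned e D q -> spanned e D (p + q).
Proof.
move=> [c hc] [c' hc']; exists (fun x => c x + c' x).
have := in_idealD hc hc'; congr in_ideal.
under [X in _ = _ - X]eq_bigr => x _ do rewrite scalerDl.
by rewrite big_split /=; ring.
Qed.

Lemma spannedZ e D a p : spanned e D p -> spanned e D (a *: p).
Proof.
move=> [c hc]; exists (fun x => a * c x).
have := in_idealMl a%:MP hc; congr in_ideal; rewrite mul_mpolyC scalerBr.
by congr (_ - _); rewrite scaler_sumr; apply: eq_bigr => x _; rewrite scalerA.
Qed.

Lemma spanned_ideal e D p : in_ideal G p -> spanned e D p.
Proof.
move=> hp; exists (fun _ => 0); rewrite big1 ?subr0 // => x _.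
by rewrite scale0r.
Qed.

(** Induction on the weight: a monomial with two exponents at least [e] is divisible by some leading
    monomial [m0] and can be traded for lighter ones. Otherwise all exponents but the largest are
    small. The successor [e.+1] keeps the exponent range inhabited. *)
Lemma spanned_monomials : exists e, forall D m, mdeg m = D -> spanned e.+1 D 'X_[m].
Proof.
have [e he] := leading_monomial; exists e => D m.
have [w] := ubnP (wt m); elim: w m => // w IH m; rewrite ltnS => lew degm.
have [/existsP[i /existsP[j /and3P[ij hi hj]]]|] :=
    boolP [exists i : 'I_n.+1, [exists j : 'I_n.+1,
             [&& (i < j)%N, (e <= m i)%N & (e <= m j)%N]]].
  have [m0 [Q [hm0 idQ supQ]]] := he i j ij.
  have le_m0 : (m0 <= m)%MM.
    apply/mnm_lepP => l; apply: leq_trans (hm0 l) _.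
    by case: ifP => // /orP[/eqP->|/eqP->].
  have -> : 'X_[m] = 'X_[m - m0] * ('X_[m0] + Q) + (-1) *: ('X_[m - m0] * Q).
    by rewrite mulrDr -mpolyXD submK // scaleN1r addrK.
  apply: spannedD; first by apply: spanned_ideal; exact: in_idealMl.
  apply: spannedZ; rewrite [Q]mpolyE mulr_sumr big_seq.
  elim/big_rec: _ => [|mu p hmu hp]; first by apply: spanned_ideal; exact: in_ideal0.
  apply: spannedD => //; rewrite -scalerAr -mpolyXD; apply: spannedZ.
  have [degmu wtmu] := supQ _ hmu.
  apply: IH; last by rewrite mdegD degmu -mdegD submK.
  have ewt : wt m = (wt (m - m0)%MM + wt m0)%N by rewrite -wtD submK.
  by rewrite wtD; apply: leq_trans lew; rewrite ewt ltn_add2l.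
rewrite negb_exists => /forallP small.
pose i := [arg max_(l > ord0) m l]%N.
have hsmall l : l != i -> (m l < e.+1)%N.
  rewrite /i; case: arg_maxnP => // i' _ hmax li; rewrite ltnS leqNgt; apply/negP => el.
  have ei : (e < m i')%N by apply: leq_trans el _; exact: hmax.
  move: li; rewrite neq_ltn => /orP[lt|lt].
    by have := small l; rewrite negb_exists => /forallP/(_ i'); rewrite lt (ltnW el) (ltnW ei).
  by have := small i'; rewrite negb_exists => /forallP/(_ l); rewrite lt (ltnW el) (ltnW ei).
(* The value 0 at [i] is arbitrary: the total degree determines that exponent. *)
pose phi : {ffun 'I_n.+1 -> 'I_e.+1} := [ffun l => inord (if l == i then 0 else m l)%N].
have hphi l : l != i -> phi l = m l :> nat.
  by move=> li; rewrite ffunE (negbTE li) inordK //; exact: hsmall.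
exists (fun x => (x == (i, phi))%:R); rewrite (bigD1 (i, phi)) //= eqxx scale1r big1.
  rewrite addr0 [tall_monomial _ _](_ : _ = m) ?subrr; first exact: in_ideal0.
  apply/mnmP => l; rewrite mnmE /=; have [->|li] := eqVneq l i; last exact: hphi.
  by rewrite (eq_bigr m hphi) -degm mdegE (bigD1 i) //= addnK.
by move=> x /negbTE->; rewrite scale0r.
Qed.

End Reduction.

(** * Lifting from characteristic p *)

Section Lift.
Variables (p : nat) (p_prime : prime p) (n : nat).

Lemma lift_poly (q : {mpoly 'F_p[n.+1]}) : exists q', map_mpoly intr q' = q.
Proof.
exists (\sum_(m <- msupp q) (q@_m : nat)%:Z *: 'X_[m]).
rewrite raddf_sum [RHS]mpolyE; apply: eq_bigr => m _ /=.
by rewrite map_mpolyZ map_mpolyX /= -pmulrn natr_Zp.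
Qed.

Lemma red_eq0 (q : {mpoly int[n.+1]}) :
  map_mpoly (intr : int -> 'F_p) q = 0 -> exists q', q = p%:Z *: q'.
Proof.
move=> q0; exists (\sum_(m <- msupp q) (q@_m %/ p)%Z *: 'X_[m]).
rewrite scaler_sumr {1}[q]mpolyE; apply: eq_bigr => m _.
rewrite scalerA mulrC; congr (_ *: _); apply/esym/divzK.
rewrite (dvdz_pcharf (pchar_Fp p_prime)) -mcoeff_map_mpoly.
by rewrite q0 mcoeff0.
Qed.

Variables (r g : nat) (G : 'I_r -> {mpoly int[n.+1]}).
Hypothesis hG : forall l, G l \is g.-homog.
Hypothesis hP : forall i j : 'I_n.+1, (i < j)%N ->
  exists P : {mpoly 'F_p[n.+1]},
  [/\ P != 0, binary i j P & in_ideal (fun l => map_mpoly intr (G l)) P].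

Lemma homog_map_mpoly (R S : nzRingType) (f : {rmorphism R -> S}) e
    (q : {mpoly R[n.+1]}) : q \is e.-homog -> map_mpoly f q \is e.-homog.
Proof.
move=> hq; apply/dhomogP => m; rewrite mcoeff_msupp mcoeff_map_mpoly => nz.
apply: (dhomog_mf hq); rewrite mcoeff_msupp.
by apply: contraNneq nz => ->; rewrite raddf0.
Qed.

(** Lift the coefficients of the relation modulo [p]: the error reduces to 0, hence is divisible by
    [p]. Everything is then projected to degree [D], which also discards the tall monomials in which
    the truncated subtraction gave a degree above [D]. *)
Lemma lifted_span : exists e, forall D (m : 'X_{1..n.+1}), mdeg m = D ->
  exists (c : 'I_n.+1 * {ffun 'I_n.+1 -> 'I_e} -> int) (q t : {mpoly int[n.+1]}),
  [/\ in_ideal G q, t \is D.-homog &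
    'X_[m] = \sum_x c x *: pihomog mdeg D 'X_[tall_monomial D x] + q + p%:Z *: t].
Proof.
pose Gp l := map_mpoly (intr : int -> 'F_p) (G l).
have hGp l : Gp l \is g.-homog by exact: homog_map_mpoly.
have [e he] := spanned_monomials hGp hP.
exists e.+1 => D m hm; have [c [q eq]] := he D m hm.
have /fin_all_exists[Q hQ] := fun l => lift_poly (q l).
pose c' x := (c x : nat)%:Z.
pose P := 'X_[m] - \sum_x c' x *: 'X_[tall_monomial D x] - \sum_l Q l * G l.
have [t ht] : exists t, P = p%:Z *: t.
  apply: red_eq0; pose red : {rmorphism {mpoly int[n.+1]} -> {mpoly 'F_p[n.+1]}} :=
    map_mpoly (intr : {rmorphism int -> 'F_p}).
  have redX m' : red 'X_[m'] = 'X_[m'] by rewrite /red /= map_mpolyX.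
  have redZ s q' : red (s *: q') = s%:~R *: red q' by rewrite /red /= map_mpolyZ.
  have redQ l : red (Q l * G l) = q l * Gp l by rewrite rmorphM /= hQ.
  rewrite -[LHS]/(red P); clearbody red.
  rewrite /P !rmorphB redX !rmorph_sum (eq_bigr _ (fun l _ => redQ l)).
  under [X in _ - X - _ = _]eq_bigr => x _ do rewrite redZ redX -pmulrn natr_Zp.
  by rewrite eq subrr.
exists c', (pihomog mdeg D (\sum_l Q l * G l)), (pihomog mdeg D t); split.
- by apply: in_ideal_pihomog hG _; exists Q.
- exact: pihomogP.
have eX : 'X_[m] = \sum_x c' x *: 'X_[tall_monomial D x] + \sum_l Q l * G l + P.
  by rewrite [RHS]addrC /P -[X in X + _]addrA -opprD subrK.
clearbody P; have := congr1 (pihomog mdeg D) eX; rewrite pihomogX /= hm eqxx => ->.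
rewrite !pihomogD ht.
by rewrite linearZ raddf_sum /=; under eq_bigr => x _ do rewrite linearZ /=.
Qed.

Variable K : numFieldType.

(* Over [K] the vector of monomials of degree [D], evaluated at a zero of [G],
   satisfies [(1 - p R) X = C b] with integral [R] and [C]; since
   [det (1 - p R) = 1] modulo [p], it lies in a space of dimension independent
   of [D]. *)
Lemma binary_relation (i j : 'I_n.+1) : i != j ->
  exists D (w : 'rV[K]_D.+1), w != 0 /\
  forall v : 'I_n.+1 -> K, (forall l, (map_mpoly intr (G l)).@[v] = 0) ->
    \sum_(a < D.+1) w 0 a * v i ^+ (D - a) * v j ^+ a = 0.
Proof.
move=> ij; have [e he] := lifted_span.
pose I := ('I_n.+1 * {ffun 'I_n.+1 -> 'I_e})%type.
(* The index set [I] does not depend on the degree, so the degree may be its cardinality: the [D.+1]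
   monomials of degree [D] in x_i and x_j then outnumber it, and a linear relation [w] exists. *)
pose D := #|{: I}|; pose T := {a : 'X_{1..n.+1 < D.+1} | mdeg a == D}.
have /fin_all_exists[c hc] : forall a : T, exists c : I -> int,
  exists q t, [/\ in_ideal G q, t \is D.-homog &
  'X_[val a] = \sum_x c x *: pihomog mdeg D 'X_[tall_monomial D x] + q + p%:Z *: t].
  by move=> a; apply: he; exact/eqP/(valP a).
have /fin_all_exists[t ht] : forall a : T, exists t : {mpoly int[n.+1]},
  exists q, [/\ in_ideal G q, t \is D.-homog &
  'X_[val a] = \sum_x c a x *: pihomog mdeg D 'X_[tall_monomial D x] + q + p%:Z *: t].
  by move=> a; have [q [t ?]] := hc a; exists t, q.
pose nT := #|{: T}|; pose nI := #|{: I}|.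
pose eT (a : 'I_nT) : T := enum_val a; pose eI (x : 'I_nI) : I := enum_val x.
pose R : 'M[int]_nT := \matrix_(a, b) (t (eT a))@_(val (eT b)).
pose M := 1%:M - p%:Z *: R.
have nzM : \det M != 0.
  have: (\det M)%:~R != 0 :> 'F_p.
    rewrite -det_map_mx map_mxB map_mxZ map_mx1 /= -pmulrn (pchar_Fp_0 p_prime).
    by rewrite scale0r subr0 det1 oner_neq0.
  by apply: contraNneq => ->.
pose MK := map_mx (intr : {rmorphism int -> K}) M.
have uM : MK \in unitmx by rewrite unitmxE det_map_mx unitfE intr_eq0.
pose C : 'M[K]_(nT, nI) := \matrix_(a, x) (c (eT a) (eI x))%:~R.
pose mon (a : nat) := (U_(i) *+ (D - a) + U_(j) *+ a)%MM.
have deg_mon (a : 'I_D.+1) : mdeg (mon a) = D.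
  by rewrite mdegD !mdegMn !mdeg1 !mul1n subnK // -ltnS.
have lt_mon (a : 'I_D.+1) : (mdeg (mon a) < D.+1)%N by rewrite deg_mon.
have eq_mon (a : 'I_D.+1) : mdeg (BMultinom (lt_mon a)) == D by rewrite /= deg_mon.
pose sel (a : 'I_D.+1) : T := Sub (BMultinom (lt_mon a)) (eq_mon a).
pose E : 'M[K]_(D.+1, nI) := rowsub (fun a => enum_rank (sel a) : 'I_nT) (invmx MK *m C).
have [w nzw wE] : exists2 w : 'rV[K]_D.+1, w != 0 & w *m E = 0.
  have : ~~ row_free E.
    rewrite /row_free neq_ltn; apply/orP; left.
    by apply: leq_ltn_trans (rank_leq_col _) _; rewrite ltnS.
  rewrite -kermx_eq0 => /rowV0Pn[w /sub_kermxP wE nzw]; by exists w.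
exists D, w; split=> // v hv.
pose phi : {rmorphism {mpoly int[n.+1]} -> K} :=
  meval v \o map_mpoly (intr : {rmorphism int -> K}).
have phiZ s q : phi (s *: q) = s%:~R * phi q by rewrite /phi /= map_mpolyZ mevalZ.
have phiX m : phi 'X_[m] = \prod_l v l ^+ m l by rewrite /phi /= map_mpolyX mevalX.
have phi_ideal q : in_ideal G q -> phi q = 0.
  move=> [q' ->]; rewrite rmorph_sum big1 // => l _.
  by rewrite rmorphM [phi (G l)]hv mulr0.
pose X : 'cV[K]_nT := \col_a phi 'X_[val (eT a)].
pose b : 'cV[K]_nI := \col_x phi (pihomog mdeg D 'X_[tall_monomial D (eI x)]).
clearbody phi.
have MX : MK *m X = C *m b.
  apply/matrixP => a z; rewrite /MK map_mxB map_mx1 map_mxZ mulmxBl mul1mx.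
  have [q [idq homt eX]] := ht (eT a).
  rewrite -scalemxAl !mxE {1}eX {1}(dhomog_exponentE homt).
  rewrite !rmorphD rmorph_sum phi_ideal // addr0 phiZ rmorph_sum -addrA.
  have -> : \sum_(a' : T) phi ((t (eT a))@_(val a') *: 'X_[val a']) =
      \sum_y map_mx intr R a y * X y z.
    rewrite (big_enum_val (fun a' : T => phi ((t (eT a))@_(val a') *: 'X_[val a']))) /=.
    by apply: eq_bigr => y _; rewrite !mxE phiZ.
  rewrite subrr addr0.
  rewrite (big_enum_val (fun x : I => phi (c (eT a) x *: pihomog mdeg D _))) /=.
  by apply: eq_bigr => y _; rewrite !mxE phiZ.
have XE : X = invmx MK *m C *m b by rewrite -mulmxA -MX mulKmx.
have wX : w *m rowsub (fun a => enum_rank (sel a) : 'I_nT) X = 0.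
  by rewrite XE -mul_rowsub_mx mulmxA wE mul0mx.
have /matrixP/(_ 0 0) := wX; rewrite mxE [RHS]mxE => wX0; rewrite -[RHS]wX0.
apply: eq_bigr => a _.
rewrite !mxE /eT enum_rankK phiX -mulrA; congr (_ * _).
rewrite (bigD1 i) //= (bigD1 j) 1?eq_sym //= big1 => [|l /andP[li lj]].
  by rewrite mulr1 !mnmE !mulmnE !mnm1E !eqxx eq_sym (negbTE ij) mul0n !mul1n addn0.
by rewrite !mnmE !mulmnE !mnm1E ![_ == l]eq_sym (negbTE li) (negbTE lj).
Qed.

End Lift.

(** * Counting sign patterns *)

(** Substitution respects congruence modulo an ideal; this replaces h_l by - u_l in Perron's
    relation. *)
Lemma in_ideal_mmapB (R S : comNzRingType) (N r k : nat) (G : 'I_r -> {mpoly S[N]})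
    (f : {rmorphism R -> {mpoly S[N]}}) (a b : 'I_k -> {mpoly S[N]}) (Q : {mpoly R[k]}) :
  (forall l, in_ideal G (a l - b l)) -> in_ideal G (mmap f a Q - mmap f b Q).
Proof.
move=> hab; rewrite /mmap -sumrB; apply: in_ideal_sum => m _.
rewrite -mulrBr; apply: in_idealMl; rewrite /mmap1.
apply: (big_ind2 (fun x y => in_ideal G (x - y))).
- by rewrite subrr; exact: in_ideal0.
- move=> x1 x2 y1 y2 h1 h2.
  have -> : x1 * y1 - x2 * y2 = y1 * (x1 - x2) + x2 * (y1 - y2) by ring.
  by apply: in_idealD; exact: in_idealMl.
move=> l _; elim: (m l) => [|e IH]; first by rewrite !expr0 subrr; exact: in_ideal0.
have -> : a l ^+ e.+1 - b l ^+ e.+1 = a l ^+ e * (a l - b l) + b l * (a l ^+ e - b l ^+ e).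
  by rewrite !exprS; ring.
by apply: in_idealD; exact: in_idealMl.
Qed.

Lemma map_mpoly_mderiv (R S : nzRingType) (f : {rmorphism R -> S}) (N : nat)
    (i : 'I_N) (p : {mpoly R[N]}) : map_mpoly f p^`M(i) = (map_mpoly f p)^`M(i).
Proof.
by apply/mpolyP => m; rewrite mcoeff_map_mpoly !mcoeff_deriv mcoeff_map_mpoly raddfMn.
Qed.

(** * Separating two variables from the others *)

Section TwoVariables.
Variables (F : fieldType) (k : nat) (i : 'I_k.+2) (j : 'I_k.+1).

Let A := {mpoly F[2]}.
Let S := {mpoly F[k.+2]}.

(** Indexing the second variable as [lift i j] builds in that it differs from the first;
    [lift i (lift j c)] then runs through the remaining ones. *)
Definition two_vars : 'I_2 -> S :=
  fun t => if t == ord0 then 'X_i else 'X_(lift i j).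
Definition iota2 : A -> S := mmap (@mpolyC k.+2 F) two_vars.
HB.instance Definition _ := GRing.RMorphism.on iota2.

Definition other_var (c : 'I_k) : S := 'X_(lift i (lift j c)).

Lemma iota2X (a b : nat) :
  iota2 'X_[U_(ord0) *+ a + U_(ord_max) *+ b] =
  'X_[U_(i) *+ a + U_(lift i j) *+ b].
Proof.
rewrite /iota2 mmapX /mmap1 !big_ord_recl big_ord0 mulr1 mpolyXD -!mpolyXn.
by rewrite !mnmE !mulmnE !mnm1E !mul1n addn0.
Qed.

Lemma iota2Z c p : iota2 (c *: p) = c *: iota2 p.
Proof. by rewrite /iota2 mmapZ mul_mpolyC. Qed.

Lemma iota2_inj : injective iota2.
Proof.
pose back : {rmorphism S -> A} := mmap (@mpolyC 2 F)
  (fun l => if l == i then 'X_ord0 else if l == lift i j then 'X_ord_max else 0).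
apply: (can_inj (g := back)) => p.
rewrite /iota2 rmorph_mmap -[RHS]comp_mpoly_id /comp_mpoly /mmap.
apply: eq_bigr => m _; congr (_ * _); first by rewrite /= /back /= mmapC.
apply: mmap1_eq => t; rewrite /= tnth_mktuple /two_vars /back.
case: (t =P ord0) => [->|nt] /=; rewrite mmapX mmap1U ?eqxx //.
rewrite eq_sym (negbTE (neq_lift _ _)) ?eqxx; congr 'X__.
by apply: val_inj; case: t nt => [[|[|]]] //= ? nt; case: nt; apply: val_inj.
Qed.

Lemma iota2_binary (p : A) : binary i (lift i j) (iota2 p).
Proof.
rewrite /iota2 /mmap; apply: supported_sum => m _.
rewrite mul_mpolyC; apply: supportedZ.
have -> : mmap1 two_vars m = 'X_[U_(i) *+ m ord0 + U_(lift i j) *+ m ord_max].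
  rewrite -iota2X /iota2 mmapX; congr mmap1.
  apply/mnmP => t; rewrite !mnmE !mulmnE !mnm1E.
  by case: t => [[|[|]]] //= lt; rewrite ?mul1n ?mul0n ?addn0 ?add0n;
    congr (m _); apply: val_inj.
apply: supportedX => l li lj; rewrite !mnmE !mulmnE !mnm1E.
by rewrite ![_ == l]eq_sym (negbTE li) (negbTE lj).
Qed.

(** Perron's theorem is to be applied with the polynomials in the two chosen variables as
    coefficient ring; the degree in the other [k] variables is at most the total degree. *)
Lemma split_variables D (q : S) : (msize q <= D.+1)%N ->
  exists P : {mpoly A[k]}, (msize P <= D.+1)%N /\ mmap iota2 other_var P = q.
Proof.
move=> hq.
pose co (m : 'X_{1..k.+2}) : A := 'X_[U_(ord0) *+ m i + U_(ord_max) *+ m (lift i j)].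
pose ot (m : 'X_{1..k.+2}) := [multinom m (lift i (lift j c)) | c < k].
exists (\sum_(m <- msupp q) (q@_m *: co m) *: 'X_[ot m]); split.
  rewrite big_seq; elim/big_rec: _ => [|m P hm hP]; first by rewrite mmeasure0.
  apply: leq_trans (mmeasureD_le _ _ _) _; rewrite geq_max hP andbT.
  apply: leq_trans (msizeZ_le _ _) _; rewrite msizeX.
  have := leq_trans (msize_mdeg_lt hm) hq; rewrite !mdegE (bigD1_ord i) //= (bigD1_ord j) //=.
  have -> : (\sum_(c < k) ot m c = \sum_(c < k) m (lift i (lift j c)))%N.
    by apply: eq_bigr => c _; rewrite mnmE.
  by move=> lt; apply: leq_ltn_trans lt; rewrite addnA leq_addl.
rewrite raddf_sum [RHS]mpolyE; apply: eq_bigr => m _ /=.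
rewrite mmapZ mmapX /= iota2Z iota2X -scalerAl; congr (_ *: _).
rewrite mpolyXD -!mpolyXn [RHS]mpolyXE_id.
rewrite (bigD1_ord i) //= (bigD1_ord j) //= mulrA; congr (_ * _).
by apply: eq_bigr => c _; rewrite mnmE.
Qed.

End TwoVariables.

(* Imported only here because these libraries interfere with the views on
   finite quantifiers used above. *)
From mathcomp Require Import complex boolp classical_sets reals constructive_ereal ereal.
From mathcomp Require Import measure lebesgue_measure probability.

(** Boolean signs give the same form over the integers, modulo 3 and over [R[i]]. *)
Definition sign_form (K : nzRingType) n d (s : exponent n d -> bool) : {mpoly K[n.+1]} :=
  \sum_a (-1) ^+ s a *: 'X_[val a].

Lemma map_sign_form (K L : nzRingType) (f : {rmorphism K -> L}) n d
    (s : exponent n d -> bool) :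
  map_mpoly f (sign_form K s) = sign_form L s.
Proof.
rewrite /sign_form raddf_sum; apply: eq_bigr => a _ /=.
by rewrite map_mpolyZ map_mpolyX rmorphXn rmorphN1.
Qed.

Lemma sign_form_homog (K : nzRingType) n d (s : exponent n d -> bool) :
  sign_form K s \is d.-homog.
Proof.
apply: rpred_sum => a _; apply: rpredZ; rewrite dhomogX; exact: (valP a).
Qed.

Lemma mderiv_homog (K : nzRingType) n d (p : {mpoly K[n]}) i :
  p \is d.-homog -> p^`M(i) \is (d - 1).-homog.
Proof.
move=> hp; apply/dhomogP => m; rewrite mcoeff_msupp mcoeff_deriv => nz.
have : (m + U_(i))%MM \in msupp p.
  by rewrite mcoeff_msupp; apply: contraNneq nz => ->; rewrite mul0rn.
by move/(dhomog_mf hp) => /= <-; rewrite mdegD mdeg1 addnK.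
Qed.

Definition has_binary n d (s : exponent n d -> bool) (i j : 'I_n.+1) :=
  exists P : {mpoly 'F_3[n.+1]},
  [/\ P != 0, binary i j P
    & in_ideal (fun l => map_mpoly intr (sign_form int s)^`M(l)) P].

(** * Counting sign patterns for one pair of variables *)

Section Count.
Variables (k d : nat) (d_gt0 : (0 < d)%N) (i : 'I_k.+2) (j : 'I_k.+1).

Let b_max := ((d - 1) %/ 3)%N.
Let T := {ffun 'I_b_max.+1 -> bool}.

(** Modulo 3 its derivatives in all variables other than x_i vanish, because x_j occurs to a power
    divisible by 3. *)
Definition cubic_part (b : nat) : 'X_{1..k.+2} :=
  (U_(i) *+ (d - 1 - 3 * b) + U_(lift i j) *+ (3 * b))%MM.

Lemma special_deg (l : 'I_k.+1) (b : 'I_b_max.+1) :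
  mdeg (U_(lift i l) + cubic_part b)%MM = d.
Proof.
rewrite !mdegD !mdegMn !mdeg1 !mul1n; have := ltn_ord b; rewrite /b_max.
by move: d_gt0; lia.
Qed.

Lemma special_bound (x : 'I_k.+1 * 'I_b_max.+1) :
  (mdeg (U_(lift i x.1) + cubic_part x.2)%MM < d.+1)%N.
Proof. by rewrite special_deg. Qed.

Lemma special_eq (x : 'I_k.+1 * 'I_b_max.+1) : mdeg (BMultinom (special_bound x)) == d.
Proof. by rewrite /= special_deg. Qed.

Definition special (x : 'I_k.+1 * 'I_b_max.+1) : exponent k.+1 d :=
  Sub (BMultinom (special_bound x)) (special_eq x).

Lemma special_lift (x : 'I_k.+1 * 'I_b_max.+1) (l : 'I_k.+1) :
  val (special x) (lift i l) = ((x.1 == l) + 3 * (x.2 * (j == l)))%N.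
Proof.
rewrite /= !mnmE !mulmnE !mnm1E !(inj_eq lift_inj) (negbTE (neq_lift _ _)).
by rewrite mul0n add0n [RHS]addnC [LHS]addnC; congr addn; case: (j == l); lia.
Qed.

(** The exponents outside x_i, taken modulo 3, reveal the first index; the exponent of x_j then
    gives the second. *)
Lemma special_inj : injective special.
Proof.
move=> x y exy.
have h l : ((x.1 == l) + 3 * (x.2 * (j == l)) = (y.1 == l) + 3 * (y.2 * (j == l)))%N.
  by rewrite -!special_lift exy.
have e1 : x.1 = y.1.
  by apply/eqP; rewrite eq_sym; have := h x.1; rewrite eqxx; case: (_ == _) => //; lia.
have := h j; rewrite e1 eqxx !muln1 => e2.
have e3 : x.2 = y.2 by apply: val_inj; move: e2 => /=; lia.
by case: x y e1 e3 {exy h e2} => [? ?] [? ?] /= -> ->.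
Qed.

(** Twisting replaces conditioning on the nonspecial signs: for fixed [s] only the special signs
    vary with [tau], and for fixed [tau] the twist permutes the sign patterns. *)
Definition twist (s : {ffun exponent k.+1 d -> bool}) (tau : {ffun 'I_k.+1 -> T}) :
    {ffun exponent k.+1 d -> bool} :=
  [ffun a => s a (+) (if [pick x | special x == a] is Some x then tau x.1 x.2 else false)].

Lemma twist_special s tau x : twist s tau (special x) = s (special x) (+) tau x.1 x.2.
Proof.
rewrite ffunE; case: pickP => [y /eqP/special_inj -> //|/(_ x)].
by rewrite eqxx.
Qed.

Lemma twist_nonspecial s tau a : a \notin [set special x | x : _] -> twist s tau a = s a.
Proof.
move=> na; rewrite ffunE; case: pickP => [x /eqP ex|_]; last by rewrite addbF.
by case/finset.imsetP: na; exists x.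
Qed.

Lemma twistK tau : involutive (twist^~ tau).
Proof.
move=> s; apply/ffunP => a; rewrite !ffunE; case: pickP => [x _|_].
  by rewrite -addbA addbb addbF.
by rewrite !addbF.
Qed.

Variable s : {ffun exponent k.+1 d -> bool}.

Definition rest_mderiv (l : 'I_k.+1) : {mpoly 'F_3[k.+2]} :=
  (\sum_(a | a \notin [set special x | x : _]) (-1) ^+ s a *: 'X_[val a])^`M(lift i l).

Definition cubic_form (l : 'I_k.+1) (t : T) : {mpoly 'F_3[2]} :=
  \sum_(b < b_max.+1) (-1) ^+ (s (special (l, b)) (+) t b) *:
    'X_[U_(ord0) *+ (d - 1 - 3 * b) + U_(ord_max) *+ (3 * b)].

(* In characteristic 3 the derivative with respect to [x_l] sees, among the
   special monomials, only the products of [x_l] by a monomial in cubes. *)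
Lemma mderiv_special (l : 'I_k.+1) x :
  ('X_[val (special x)] : {mpoly 'F_3[k.+2]})^`M(lift i l) =
  if x.1 == l then 'X_[cubic_part x.2] else 0.
Proof.
rewrite mderivX special_lift natrD natrM [3%:R](pchar_Fp_0 (isT : prime 3)).
rewrite mul0r addr0; case: eqP => [<-|_]; last by rewrite scale0r.
by rewrite scale1r /= addmC addmK.
Qed.

(** This partial sees [tau] only through [tau l], so the perturbations of the partials vary
    independently, as Schwartz-Zippel requires. *)
Lemma mderiv_twist tau l :
  (sign_form 'F_3 (twist s tau))^`M(lift i l) =
  rest_mderiv l + iota2 i j (cubic_form l (tau l)).
Proof.
rewrite /sign_form (bigID (mem [set special x | x : _])) /= mderivD addrC.
rewrite (eq_bigr (fun a => (-1) ^+ s a *: 'X_[val a])) => [|a na]; last first.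
  by rewrite twist_nonspecial.
rewrite -/(rest_mderiv l); apply: (congr1 (+%R (rest_mderiv l))).
rewrite big_imset /=; last by move=> x y _ _ /special_inj.
rewrite (eq_bigl xpredT) => [|x]; last by rewrite inE.
pose E x := (-1) ^+ twist s tau (special x) *: 'X_[val (special x)] : {mpoly 'F_3[k.+2]}.
rewrite (raddf_sum (mderiv (lift i l))).
have -> : \sum_x (E x)^`M(lift i l) = \sum_l' \sum_b (E (l', b))^`M(lift i l).
  by rewrite pair_bigA; apply: eq_bigr => -[].
rewrite (bigD1 l) //= [X in _ + X]big1 => [|l' nl]; last first.
  rewrite big1 // => b _.
  by rewrite mderivZ mderiv_special /= (negbTE nl) scaler0.
rewrite addr0 /cubic_form raddf_sum; apply: eq_bigr => b _.
rewrite mderivZ mderiv_special eqxx twist_special /= iota2Z iota2X //.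
Qed.

(** Different [b] give different monomials, and 1 and -1 differ modulo 3, so the signs can be read
    off the coefficients. *)
Lemma cubic_form_inj l : injective (cubic_form l).
Proof.
move=> t t' e; apply/ffunP => b.
pose mon (b : nat) := (U_(ord0) *+ (d - 1 - 3 * b) + U_(ord_max) *+ (3 * b))%MM : 'X_{1..2}.
have mon_inj (b1 b2 : nat) : mon b1 = mon b2 -> b1 = b2.
  move/mnmP/(_ ord_max); rewrite !mnmE !mulmnE !mnm1E /= !mul0n !mul1n; lia.
have co t0 : (cubic_form l t0)@_(mon b) = (-1) ^+ (s (special (l, b)) (+) t0 b).
  rewrite raddf_sum (bigD1 b) //= mcoeffZ mcoeffX eqxx mulr1 big1 ?addr0 // => b' nb.
  rewrite mcoeffZ mcoeffX; case: eqP => [/mon_inj/val_inj eb|_]; last by rewrite mulr0.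
  by rewrite eb eqxx in nb.
have := co t; rewrite e co => /eqP.
by case: (s _); case: (t b); case: (t' b).
Qed.

(** If Perron's relation [Q] does not vanish at the negated cubic forms, its value there is the
    required binary form; so bad twists are among the zeros of [Q] counted by Schwartz-Zippel. *)
Lemma card_bad_twists :
  (#|[set tau : {ffun 'I_k.+1 -> T} |
      ~~ `[< has_binary (twist s tau) i (lift i j) >]]| * #|{: T}|
   <= d ^ k * #|{: T}| ^ k.+1)%N.
Proof.
have rep l : exists p : {mpoly {mpoly 'F_3[2]}[k]}, (msize p <= d)%N /\
    mmap (iota2 i j) (other_var _ i j) p = rest_mderiv l.
  have homr : rest_mderiv l \is (d - 1).-homog.
    apply: mderiv_homog; apply: rpred_sum => a _; apply: rpredZ.
    by rewrite dhomogX; exact: (valP a).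
  have := @split_variables 'F_3 k i j d.-1 (rest_mderiv l).
  rewrite prednK //; apply; rewrite msizeE; apply/bigmax_leqP_seq => m hm _.
  by rewrite (dhomog_mf homr hm); move: d_gt0; lia.
have /fin_all_exists[p hp] := rep.
have [Q [nzQ degQ relQ]] := perron_relation d_gt0 (fun l => proj1 (hp l)).
apply: leq_trans (schwartz_zippel (u := fun l t => - cubic_form l t) _ nzQ degQ); last first.
  by move=> l t t' /oppr_inj/cubic_form_inj.
rewrite leq_mul2r; apply/orP; right; apply/subset_leq_card/fintype.subsetP => tau.
rewrite !inE; apply: contraNT => nzv; apply/asboolP.
exists (iota2 i j (Q.@[fun l => - cubic_form l (tau l)])); split.
- by rewrite -(inj_eq (@iota2_inj _ _ i j)) rmorph0 in nzv.
- exact: iota2_binary.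
(* The subtracted value of [Q] is 0. The arguments of the two values differ by minus the partials,
   so their difference is in the ideal. *)
have -> : iota2 i j Q.@[fun l => - cubic_form l (tau l)] =
    mmap (iota2 i j) (fun l => - iota2 i j (cubic_form l (tau l))) Q
    - mmap (iota2 i j) rest_mderiv Q.
  have -> : mmap (iota2 i j) rest_mderiv Q = 0.
    have := congr1 (mmap (iota2 i j) (other_var _ i j)) relQ.
    rewrite raddf0 rmorph_mmap => h0; rewrite -[RHS]h0 /mmap.
    apply: eq_bigr => m _; congr (_ * _); first by rewrite /= mmapC.
    by apply: mmap1_eq => l /=; rewrite (proj2 (hp l)).
  rewrite subr0 /meval rmorph_mmap /mmap; apply: eq_bigr => m _; congr (_ * _).
  by apply: mmap1_eq => l /=; rewrite rmorphN.
apply: in_ideal_mmapB => l; rewrite -opprD -mulN1r addrC -mderiv_twist.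
apply: in_idealMl; rewrite -(map_sign_form (intr : {rmorphism int -> 'F_3})).
rewrite -map_mpoly_mderiv; exact: in_ideal_gen.
Qed.

End Count.

(** Double counting: for each [t] the preimage of the bad set under a bijection has the size of the
    bad set. *)
Lemma sum_card_twists (S T : finType) (tw : S -> T -> S) (B : pred S) :
  (forall t, injective (tw^~ t)) ->
  (\sum_s #|[set t | B (tw s t)]| = #|{: T}| * #|[set s | B s]|)%N.
Proof.
move=> inj_tw; under eq_bigr => s _ do rewrite -sum1dep_card.
rewrite (exchange_big_dep predT) //= -sum_nat_const; apply: eq_bigr => t _.
rewrite -(card_preimset _ (inj_tw t)) -sum1dep_card; apply: eq_bigl => s.
by rewrite !inE.
Qed.

Lemma card_bad_signs k d (i : 'I_k.+2) (j : 'I_k.+1) : (0 < d)%N ->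
  (#|[set s : {ffun exponent k.+1 d -> bool} |
      ~~ `[< has_binary s i (lift i j) >]]| * 2 ^ ((d - 1) %/ 3).+1
   <= d ^ k * 2 ^ #|{: exponent k.+1 d}|)%N.
Proof.
move=> d_gt0; pose T := {ffun 'I_((d - 1) %/ 3).+1 -> bool}.
pose bad (s : {ffun exponent k.+1 d -> bool}) := ~~ `[< has_binary s i (lift i j) >].
have cT : #|{: T}| = (2 ^ ((d - 1) %/ 3).+1)%N by rewrite card_ffun card_bool card_ord.
pose TT := {ffun 'I_k.+1 -> T}.
have cTT : #|{: TT}| = (#|{: T}| ^ k.+1)%N by rewrite card_ffun card_ord.
have T_gt0 : (0 < #|{: TT}|)%N by rewrite cTT cT !expn_gt0.
rewrite -(leq_pmul2l T_gt0) -cT.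
rewrite mulnA -(sum_card_twists bad (fun tau => inv_inj (twistK d_gt0 i j tau))).
rewrite big_distrl /=.
apply: leq_trans (leq_sum _ (fun s _ => card_bad_twists d_gt0 i j s)) _.
have cS : #|{: {ffun exponent k.+1 d -> bool}}| = (2 ^ #|{: exponent k.+1 d}|)%N.
  by rewrite card_ffun card_bool.
by rewrite sum_nat_const cS -cTT mulnA mulnC [(2 ^ _ * _)%N]mulnC.
Qed.

(** Union bound over the k.+2 * k.+1 ordered pairs of distinct variables, written (i, lift i j). *)
Lemma card_degenerate_signs k d : (0 < d)%N ->
  (#|[set s : {ffun exponent k.+1 d -> bool} |
      ~~ `[< forall i j : 'I_k.+2, (i < j)%N -> has_binary s i j >]]|
     * 2 ^ ((d - 1) %/ 3).+1
   <= k.+1 * k.+2 * d ^ k * 2 ^ #|{: exponent k.+1 d}|)%N.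
Proof.
move=> d_gt0; set S := [set s | _].
pose bad (x : 'I_k.+2 * 'I_k.+1) := [set s : {ffun exponent k.+1 d -> bool} |
      ~~ `[< has_binary s x.1 (lift x.1 x.2) >]].
have subS : S \subset \bigcup_x bad x.
  apply/fintype.subsetP => s; rewrite inE; apply: contraNT => /finset.bigcupP nb.
  apply/asboolP => i j ij.
  have : j != i by rewrite -val_eqE /= gtn_eqF.
  rewrite eq_sym => /unlift_some[j' ej _]; rewrite ej.
  apply/asboolP/negPn/negP => nbin; apply: nb; exists (i, j') => //.
  by rewrite inE.
apply: leq_trans (leq_mul (subset_leq_card subS) (leqnn _)) _.
apply: (@leq_trans ((\sum_x #|bad x|) * 2 ^ ((d - 1) %/ 3).+1)%N).
  rewrite leq_mul2r; apply/orP; right; apply: (big_ind2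
    (fun (A : {set {ffun exponent k.+1 d -> bool}}) m => #|A| <= m)%N).
  - by rewrite cards0.
  - by move=> A a B b hA hB; apply: leq_trans (leq_card_setU _ _) _; exact: leq_add.
  - by [].
rewrite big_distrl /=.
apply: leq_trans (leq_sum _ (fun x _ => card_bad_signs x.1 x.2 d_gt0)) _.
by rewrite sum_nat_const card_prod !card_ord mulnA [(k.+2 * _)%N]mulnC.
Qed.

Local Open Scope classical_set_scope.

(** * Irreducible sets of singular points *)

Section SingularPoints.
Variables (K : closedFieldType) (n : nat).
Implicit Types (f g : {mpoly K[n.+1]}).

Lemma mderivE i f :
  f^`M(i) = \sum_(m <- msupp f) f@_m *: ((m i)%:R *: 'X_[m - U_(i)]).
Proof.
rewrite {1}[f]mpolyE raddf_sum; apply: eq_bigr => m _ /=.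
by rewrite mderivZ mderivX.
Qed.

Lemma dehomogenizeX i (m : 'X_{1..n.+1}) :
  dehomogenize i 'X_[m] = 'X_[[multinom m (lift i k) | k < n]] :> {mpoly K[n]}.
Proof.
rewrite /dehomogenize comp_mpolyX mpolyXE_id (bigD1_ord i) //=.
rewrite tnth_mktuple unlift_none /= expr1n mul1r; apply: eq_bigr => k _.
by rewrite tnth_mktuple liftK /= mnmE.
Qed.

Lemma mderiv_dehomogenize i (k : 'I_n) f (v : 'I_n.+1 -> K) : v i = 1 ->
  ((dehomogenize i f)^`M(k)).@[fun j => v (lift i j)] = (f^`M(lift i k)).@[v].
Proof.
move=> vi; have -> : dehomogenize i f = \sum_(m <- msupp f) f@_m *: dehomogenize i 'X_[m].
  rewrite /dehomogenize {1}[f]mpolyE raddf_sum; apply: eq_bigr => m _ /=.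
  by rewrite comp_mpolyZ.
rewrite [X in _ = X.@[_] ]mderivE (raddf_sum (mderiv k)).
rewrite [LHS](raddf_sum (meval _)) [RHS](raddf_sum (meval _)).
apply: eq_bigr => m _ /=; rewrite dehomogenizeX.
rewrite mderivZ mderivX mnmE !mevalZ; congr (_ * (_ * _)).
rewrite !mevalX [RHS](bigD1_ord i) //= vi expr1n mul1r; apply: eq_bigr => j _.
by rewrite !mnmE (inj_eq lift_inj).
Qed.

Lemma euler_identity d f (v : 'I_n.+1 -> K) : f \is d.-homog ->
  \sum_i v i * (f^`M(i)).@[v] = d%:R * f.@[v].
Proof.
move=> hf; under eq_bigr => i _ do rewrite mderivE raddf_sum mulr_sumr.
rewrite exchange_big {3}[f]mpolyE raddf_sum mulr_sumr big_seq [RHS]big_seq.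
apply: eq_bigr => m hm /=; rewrite -(dhomog_mf hf hm) /= mdegE natr_sum mulr_suml.
apply: eq_bigr => i _; rewrite !mevalZ !mevalX.
(* If [m i] is 0, the subtraction of [U_(i)] truncates, but the coefficient vanishes. *)
have [->|nz] := posnP (m i); first by rewrite !(mul0r, mulr0).
rewrite mulrCA [RHS]mulrCA; congr (_ * _); rewrite mulrCA; congr (_ * _).
rewrite (bigD1 i) //= [RHS](bigD1 i) //= mulrA; congr (_ * _).
  by rewrite !mnmE eqxx -exprS subn1 prednK.
by apply: eq_bigr => j ji; rewrite !mnmE eq_sym (negbTE ji) subn0.
Qed.

Lemma line_generator (p : proj K n) : exists2 v, v != 0 & line p = <[v]>%VS.
Proof.
case: p => L /= dL; exists (vpick L).
  by rewrite vpick0 -dimv_eq0 (eqP dL).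
apply/esym/eqP; rewrite eqEdim (eqP dL) dim_vline vpick0 -dimv_eq0 (eqP dL).
by rewrite -memvE memv_pick.
Qed.

Lemma proj_inj (p q : proj K n) : line p = line q -> p = q.
Proof.
case: p q => [L dL] [L' dL'] /= e; case: _ / e dL' => dL'.
by rewrite (eq_irrelevance dL dL').
Qed.

Lemma meval_homog e g (c : K) (v : 'I_n.+1 -> K) : g \is e.-homog ->
  g.@[fun l => c * v l] = c ^+ e * g.@[v].
Proof.
move=> hg; rewrite !mevalE mulr_sumr big_seq [RHS]big_seq; apply: eq_bigr => m hm.
under eq_bigr => i _ do rewrite exprMn.
rewrite big_split /= mulrCA; congr (_ * (_ * _)).
by rewrite prodrXr -(dhomog_mf hg hm) /= mdegE.
Qed.

Lemma vanishes_generator e g (p : proj K n) (v : 'rV[K]_n.+1) : g \is e.-homog ->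
  line p = <[v]>%VS -> g.@[v ord0] = 0 -> vanishes g p.
Proof.
move=> hg ep gv u; rewrite ep => /vlineP[c ->].
rewrite -[RHS](mulr0 (c ^+ e)) -gv -(meval_homog _ _ hg).
by apply: meval_eq => l; rewrite mxE.
Qed.

(** Non-smoothness in the chart x_i = 1 kills the partials along the other variables; Euler's
    identity gives the remaining one. *)
Lemma Sing_mderiv d f (p : proj K n) i (v : 'rV[K]_n.+1) : f \is d.-homog ->
  Sing f p -> v \in line p -> v ord0 i = 1 ->
  forall l, (f^`M(l)).@[v ord0] = 0.
Proof.
move=> hf [fp nsm] vp vi.
have part k : (f^`M(lift i k)).@[v ord0] = 0.
  rewrite -(mderiv_dehomogenize k f vi); apply/eqP/negPn/negP => nz; apply: nsm.
  by exists i, v; split=> //; exists k.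
move=> l; case: (unliftP i l) => [k|] -> //.
have := euler_identity (v ord0) hf; rewrite (fp v vp) mulr0 (bigD1_ord i) //= vi.
by rewrite mul1r big1 ?addr0 // => k _; rewrite part mulr0.
Qed.

Lemma zariski_closed1 e g : g \is e.-homog ->
  zariski_closed [set p : proj K n | vanishes g p].
Proof.
move=> hg; exists [set g]; split; first by move=> _ ->; exists e.
by apply/seteqP; split => p /= hp; [move=> _ -> | exact: hp].
Qed.

(** Irreducibility is applied factor by factor; nonemptiness of [Z] excludes the empty product,
    which is 1 everywhere. *)
Lemma irreducible_prod (Z : set (proj K n)) (gs : seq {mpoly K[n.+1]}) :
  irreducible Z -> (forall g, g \in gs -> exists e, g \is e.-homog) ->
  (forall p, Z p -> forall v, v \in line p -> (\prod_(g <- gs) g).@[v ord0] = 0) ->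
  exists2 g, g \in gs & forall p, Z p -> vanishes g p.
Proof.
move=> irrZ; elim: gs => [|g gs IH] hom van.
  have [[p Zp] _] := irrZ; have := van p Zp 0 (mem0v _).
  by rewrite big_nil meval1 => /eqP; rewrite oner_eq0.
have hgs : exists e, \prod_(g <- gs) g \is e.-homog.
  rewrite big_seq; elim/big_rec: _ => [|h p hh [e hp]]; first by exists 0%N; exact: dhomog1.
  have [e' he'] := hom h (mem_behead (s := g :: gs) hh).
  by exists (e' + e)%N; exact: dhomogM.
have [e he] := hom g (mem_head _ _); have [e' he'] := hgs.
have [] := proj2 irrZ _ _ (zariski_closed1 he) (zariski_closed1 he').
- move=> p Zp; have [v nzv ep] := line_generator p.
  have := van p Zp v; rewrite ep memv_line big_cons mevalM => /(_ isT)/eqP.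
  rewrite mulf_eq0 => /orP[/eqP h|/eqP h]; [left|right].
    exact: vanishes_generator he ep h.
  exact: vanishes_generator he' ep h.
- by move=> hZ; exists g; rewrite ?mem_head.
move=> hZ; have [|p Zp v vp|h hh hv] := IH; last by exists h; rewrite // inE hh orbT.
  by move=> h hh; apply: hom; rewrite inE hh orbT.
exact: hZ p Zp v vp.
Qed.

Variables (d : nat) (f : {mpoly K[n.+1]}).
Hypothesis hf : f \is d.-homog.
Hypothesis relation : forall i j : 'I_n.+1, i != j ->
  exists D (w : 'rV[K]_D.+1), w != 0 /\
  forall v : 'I_n.+1 -> K, (forall l, (f^`M(l)).@[v] = 0) ->
    \sum_(a < D.+1) w 0 a * v i ^+ (D - a) * v j ^+ a = 0.

(** The relation makes x_j / x_i a root of a fixed polynomial [q] wherever x_i is nonzero. With the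
    extra factor x_i, the product of the linear factors vanishes on all of [Z]; the factor that
    vanishes on [Z] is not x_i, because of [p]. *)
Lemma constant_ratio (Z : set (proj K n)) (p : proj K n) u (i j : 'I_n.+1) :
  irreducible Z -> Z `<=` Sing f -> Z p -> u \in line p -> u ord0 i != 0 -> i != j ->
  exists c, forall q, Z q -> forall v, v \in line q -> v ord0 j = c * v ord0 i.
Proof.
move=> irrZ ZS Zp up ui ij; have [D [w [nzw hw]]] := relation ij.
pose q := rVpoly w; have nzq : q != 0.
  by apply: contraNneq nzw => q0; rewrite -[w]rVpolyK -/q q0 linear0.
have [rs eq] := closed_field_poly_normal q.
pose lin r : {mpoly K[n.+1]} := 'X_j - r *: 'X_i.
have [|z Zz v vz|g] := irreducible_prod (gs := 'X_i :: [seq lin r | r <- rs]) irrZ.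
- move=> g; rewrite inE => /orP[/eqP->|/mapP[r _ ->]]; exists 1%N.
    by rewrite dhomogX /= mdeg1.
  by rewrite /lin rpredB ?rpredZ ?dhomogX //= mdeg1.
- rewrite big_cons big_map mevalM mevalXU rmorph_prod /=.
  have [->|vi] := eqVneq (v ord0 i) 0; first by rewrite mul0r.
  have h1 : (((v ord0 i)^-1 *: v) ord0 i) = 1 by rewrite mxE mulVf.
  have vz' : (v ord0 i)^-1 *: v \in line z by rewrite memvZ.
  have := hw _ (Sing_mderiv hf (ZS _ Zz) vz' h1); rewrite h1.
  set y := (_ *: v) ord0 j => hy.
  have : q.[y] = 0.
    rewrite -[RHS]hy (@horner_coef_wide _ D.+1); last exact: size_poly.
    by apply: eq_bigr => a _; rewrite coef_rVpoly_ord expr1n mulr1.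
  rewrite eq hornerZ => /eqP; rewrite mulf_eq0 lead_coef_eq0 (negbTE nzq) /=.
  rewrite -/(root _ _) root_prod_XsubC => hr.
  rewrite (big_rem y) //= /lin mevalB mevalZ !mevalXU /y mxE mulrAC.
  by rewrite mulVf // mul1r subrr mul0r mulr0.
rewrite inE => /orP[/eqP->|/mapP[r _ ->]] hZ.
  by have := hZ p Zp u up; rewrite mevalXU => /eqP; rewrite (negbTE ui).
exists r => z Zz v vz; have := hZ z Zz v vz.
by rewrite /lin mevalB mevalZ !mevalXU => /eqP; rewrite subr_eq0 => /eqP.
Qed.

(** All coordinates have constant ratios to one that is nonzero at [p], so every point of [Z] is the
    line spanned by these ratios. *)
Lemma irreducible_point (Z : set (proj K n)) (p q : proj K n) :
  irreducible Z -> Z `<=` Sing f -> Z p -> Z q -> p = q.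
Proof.
move=> irrZ ZS Zp Zq; have [u nzu ep] := line_generator p.
have up : u \in line p by rewrite ep memv_line.
have [i ui] : exists i, u ord0 i != 0 by exact/rV0Pn.
have /fin_all_exists[c hc] : forall j, exists c, forall z, Z z ->
    forall v, v \in line z -> v ord0 j = c * v ord0 i.
  move=> j; have [<-|ij] := eqVneq i j; first by exists 1 => *; rewrite mul1r.
  exact: constant_ratio irrZ ZS Zp up ui ij.
suff h z : Z z -> line z = <[\row_j c j]>%VS by apply: proj_inj; rewrite !h.
move=> Zz; have [v nzv ez] := line_generator z.
have ev : v = v ord0 i *: \row_j c j.
  by apply/rowP => j; rewrite !mxE (hc j z Zz v) ?ez ?memv_line // mulrC.
rewrite ez; apply/eqP; rewrite eqEdim -memvE !dim_vline nzv.
rewrite {1}ev memvZ ?memv_line //= leq_b1 //.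
Qed.

(** The second member of a chain would be a single point, yet properly contain the nonempty first
    one. *)
Lemma no_chain k : has_chain (Sing f) k.+1 -> False.
Proof.
move=> [Y [hY lt]]; have [_ [[p Yp] _] _] := hY 0%N isT.
have [_ irr1 sub1] := hY 1%N isT; have [le01 nle] := lt 0%N isT.
apply: nle => q Yq; rewrite -(irreducible_point irr1 sub1 (le01 _ Yp) Yq) //.
Qed.

Lemma krull_dim_Sing (R : realType) : ~ (1%:E <= krull_dim R (Sing f))%E.
Proof.
apply/negP; rewrite -ltNge; apply: (@le_lt_trans _ _ 0%:E); last by rewrite lte_fin.
apply: ge_ereal_sup => _ [->|[[|k] /= hk <-]]; rewrite ?lee_fin ?lerN10 //.
by case: (no_chain hk).
Qed.

End SingularPoints.

(** * Probability *)

Section GoodSigns.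
Variables (R : realType) (n d : nat).

Lemma good_signs (s : exponent n d -> bool) :
  (forall i j : 'I_n.+1, (i < j)%N -> has_binary s i j) ->
  ~ (1%:E <= krull_dim R (Sing (sign_form R[i] s)))%E.
Proof.
move=> good; apply: (krull_dim_Sing (sign_form_homog _ s)) => i j ij.
have hG l : (sign_form int s)^`M(l) \is (d - 1).-homog.
  exact: mderiv_homog (sign_form_homog _ s).
have [D [w [nzw hw]]] := binary_relation (isT : prime 3) hG good R[i] ij.
exists D, w; split=> // v hv; apply: hw => l.
by rewrite map_mpoly_mderiv map_sign_form hv.
Qed.

Lemma form_of_signs (s : exponent n d -> bool) (c : exponent n d -> R) :
  (forall a, c a = (-1) ^+ s a) -> form_of c = sign_form R[i] s.
Proof.
move=> hc; apply: eq_bigr => a _; rewrite hc rmorphXn rmorphN1 //.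
Qed.
End GoodSigns.

Section Probability.
Context {disp : measure_display} {Omega : measurableType disp} {R : realType}.
Variables (P : probability Omega R) (T : finType) (X : T -> {RV P >-> R}).
Hypotheses (X_sign : forall a, random_sign (X a)) (X_indep : mutually_independent X).

Definition sign_event (s : {ffun T -> bool}) : set Omega :=
  [set w | forall a, X a w = (-1) ^+ s a].

Lemma measurable_sign_event s : measurable (sign_event s).
Proof.
rewrite (_ : sign_event s = \bigcap_(a in [set: T]) (X a @^-1` [set (-1) ^+ s a])).
  apply: fin_bigcap_measurable => [|a _]; first exact: cardinality.finite_finset.
  exact: (@measurable_funPTI _ _ _ _ (X a) _ (measurable_set1 _)).
by apply/seteqP; split => w /= h a; have := h a => // /(_ I).
Qed.

Lemma prob_sign_event s : P (sign_event s) = (2^-1 ^+ #|T|)%:E.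
Proof.
have := X_indep [set: T]%SET (fun a => measurable_set1 ((-1) ^+ s a)).
rewrite (_ : [set w | _] = sign_event s) => [->|].
  rewrite (eq_bigr (fun=> (2^-1)%:E)) => [|a _]; last first.
    by have [_ h1 h2] := X_sign a; case: (s a); rewrite ?expr0 ?expr1.
  by rewrite prodEFin big_const -cardsT iter_mulr mulr1.
by apply/seteqP; split => w /= h a; have := h a; rewrite ?inE // => /(_ isT).
Qed.

(** The signs are 1 or -1 everywhere, so [E] is exactly a finite union of sign events, and
    subadditivity bounds its probability. *)
Lemma prob_sign_set (S : {set {ffun T -> bool}}) (E : set Omega) :
  (forall w (s : {ffun T -> bool}), (forall a, X a w = (-1) ^+ s a) ->
     E w <-> s \in S) ->
  (P E <= (#|S|%:R * 2^-1 ^+ #|T|)%:E)%E.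
Proof.
move=> hE.
have -> : E = \big[setU/set0]_(s <- enum S) sign_event s.
  rewrite -bigcup_seq; apply/seteqP; split => w /=.
    pose s := [ffun a => X a w == -1].
    have hs a : X a w = (-1) ^+ s a.
      have n11 : (1 == -1 :> R) = false.
        by rewrite -subr_eq0 opprK -(natrD _ 1 1) pnatr_eq0.
      by rewrite ffunE; have [/(_ w)[->|->] _ _] := X_sign a; rewrite ?n11 ?eqxx.
    by move=> Ew; exists s => //=; rewrite mem_enum -(hE w s).
  by move=> [s /= sS ws]; apply/(hE w s) => //; rewrite -mem_enum.
rewrite cardE; elim: (enum S) => [|s r IH].
  by rewrite big_nil measure0 mul0r.
rewrite big_cons; set B := \big[setU/set0]_(s' <- r) _.
have mB : measurable B by apply: bigsetU_measurable => s' _; exact: measurable_sign_event.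
apply: (@le_trans _ _ (P (sign_event s) + P B)%E).
  by apply: measureU2 => //; exact: measurable_sign_event.
rewrite prob_sign_event [size (_ :: _)]/= -[(size r).+1]add1n natrD mulrDl mul1r EFinD.
exact: leeD2l.
Qed.

End Probability.

Theorem theorem1p3 (R : realType) (n d : nat) (hn : (1 <= n)%N) (hd : (3 <= d)%N)
    (disp : measure_display) (Omega : measurableType disp)
    (P : probability Omega R) (eps : exponent n d -> {RV P >-> R})
    (eps_sign : forall a : exponent n d, random_sign (eps a))
    (eps_indep : mutually_independent eps) :
  (P [set w | 1%:E <= krull_dim R (Sing (form_of (fun a => eps a w)))]
     <= ((n * n.+1 * d ^ (n - 1))%N%:R / 2 ^+ ((d - 1) %/ 3).+1)%:E)%E.
Proof.
have d_gt0 : (0 < d)%N by exact: leq_trans hd.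
case: n hn eps eps_sign eps_indep => // k _ eps eps_sign eps_indep.
pose degenerate (s : {ffun exponent k.+1 d -> bool}) :=
  `[< (1%:E <= krull_dim R (Sing (sign_form R[i] s)))%E >].
apply: le_trans (prob_sign_set (S := finset degenerate) eps_sign eps_indep _) _.
  by move=> w s hs /=; rewrite (form_of_signs hs) inE; split => /asboolP.
rewrite lee_fin exprVn ler_pdivlMr ?exprn_gt0 // mulrAC ler_pdivrMr ?exprn_gt0 //.
rewrite -!natrX -!natrM ler_nat subSS subn0.
apply: leq_trans (card_degenerate_signs k d_gt0).
(* By [good_signs], a pattern with singular locus of positive dimension lacks a binary form for some
   pair. *)
rewrite leq_mul2r; apply/orP; right; apply/subset_leq_card/fintype.subsetP => s.
rewrite !inE => /asboolP/asboolP dimS; apply/negP => /asboolP good.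
exact: good_signs good dimS.
Qed.
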